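(* Let $n,m,r\ge 1$ and $k\ge 2$ be integers, let $A\in\mathbb{R}^{n\times n}$, $B\in\mathbb{R}^{n\times m}$, $C\in\mathbb{R}^{r\times n}$, $D\in\mathbb{R}^{r\times m}$, and consider the system $x_{t+1}=Ax_t+Bu_t+w_t$, $y_t=Cx_t+Du_t$, $t=0,1,\dots$, with random initial state $x_0\in\mathbb{R}^n$, random control inputs $u_t\in\mathbb{R}^m$ and random attacks $w_t\in\mathbb{R}^n$. Let $G^*=[D~~CB~~CAB~~\cdots~~CA^{k-2}B]\in\mathbb{R}^{r\times mk}$ and $\mathbf{U}_t^{(k)}=[u_t^T~u_{t-1}^T~\cdots~u_{t-k+1}^T]^T\in\mathbb{R}^{mk}$, and let $\mathcal{F}_t=\sigma(x_0,w_0,\dots,w_{t-1})$. Assume: (i) there are $\psi>0$ and $0\le\rho<1$ with $\|A^t\|_2\le\psi\rho^t$ for all $t\ge0$; (ii) there is $\eta>0$ such that $\|x_0\|_{\psi_2}\le\eta$ and, conditionally on $\mathcal{F}_t$, $\|w_t\|_{\psi_2}\le\eta$ for all $t\ge0$; (iii) for some $0\le p<\frac{1}{2(k-1)}$ there is a sequence $(\xi_t)_{t\ge0}$ of independent $\mathrm{Bernoulli}(p)$ variables, with $\xi_t$ independent of $\mathcal{F}_t$ for each $t$, such that $\{\xi_t=0\}\subseteq\{w_t=0\}$ for all $t\ge0$; (iv) the control inputs $u_t$ are independent with $u_t\sim N(0,\sigma^2I_m)$, $\sigma>0$. Let $q=1-(1-p)^{k-1}$ and $\nu=\frac{\|C\|_2}{1-2q}\left(\frac{\eta}{\sigma}+\sqrt{m}\,\|B\|_2\right)$.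 Let $0<\alpha\le1$ and let $G^{(t)}$, $t\in\{0,k,2k,\dots\}$, be generated by the stochastic subgradient method with the Polyak step size: $G^{(0)}=0$ and, for $t=0,k,2k,\dots$, with $f_t(G)=\|y_{t+k-1}-G\,\mathbf{U}_{t+k-1}^{(k)}\|_2$, $$g^{(t)}\in\partial f_t(G^{(t)}),\qquad \theta_t=\max\Big\{\frac{f_t(G^{(t)})-f_t(G^* )}{\|g^{(t)}\|_F^2},\,0\Big\},\qquad G^{(t+k)}=G^{(t)}-\gamma_tg^{(t)},$$ where $g^{(t)}$ is a nonzero subgradient and $\gamma_t$ is any number with $\alpha\theta_t\le\gamma_t\le(2-\alpha)\theta_t$. Then there is a constant $K>0$ (depending at most on $\psi$) such that for all $t\ge0$ that are multiples of $k$, $$\mathbb{E}\big[\|G^{(t)}-G^*\|_F^2\big]\le K\left[\left(1-\frac{(1-2q)^2(2\alpha-\alpha^2)}{2\pi\, mk}\right)^{t/k}\|G^{(0)}-G^*\|_F^2+\Big(\frac{\rho^{k-1}\nu}{1-\rho}\Big)^2\right].$$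
   Context: $\|\cdot\|_2$ is the Euclidean norm of a vector or the spectral norm of a matrix; $\|\cdot\|_F$ is the Frobenius norm; $\partial f_t$ is the convex subdifferential (with respect to the Frobenius inner product). For a scalar random variable $X$, $\|X\|_{\psi_2}=\inf\{s>0:\mathbb{E}[e^{X^2/s^2}]\le2\}$; for a random vector $X$, $\|X\|_{\psi_2}$ means $\|\,\|X\|_2\,\|_{\psi_2}$; ''$\|w_t\|_{\psi_2}\le\eta$ conditionally on $\mathcal{F}_t$'' means $\mathbb{E}[e^{\|w_t\|_2^2/\eta^2}\mid\mathcal{F}_t]\le2$ almost surely. Standing convention on the interplay of randomness: for every $t$, the future inputs $(u_s)_{s\ge t}$, the variables $(\xi_s)_{s\ge t}$ and the history $\sigma(x_0,w_0,\dots,w_{t-1},u_0,\dots,u_{t-1})$ are mutually independent. Apart from the stated assumptions, the attacks $w_t$ may be chosen arbitrarily by an adversary using historical information. The selections of $g^{(t)}$ and $\gamma_t$ are measurable functions of $G^{(t)}$, $y_{t+k-1}$, $\mathbf{U}_{t+k-1}^{(k)}$ (and the fixed quantities $G^*,\alpha$). A nonzero subgradient always exists when $\mathbf{U}_{t+k-1}^{(k)}\neq0$, which holds almost surely. *)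

(* Defs.v *)
From HB Require Import structures.
From mathcomp Require Import all_boot all_order all_algebra.
From mathcomp Require Import all_classical all_reals all_analysis.
From mathcomp Require Import measurable_realfun.

Set Implicit Arguments.
Unset Strict Implicit.
Unset Printing Implicit Defensive.

Import Order.TTheory GRing.Theory Num.Theory.
Import numFieldNormedType.Exports.

Local Open Scope classical_set_scope.
Local Open Scope ring_scope.

(* Borel sigma-algebra on matrices, generated by the coordinate maps (the same
   pattern as the library's sigma-algebra on tuples).  The library has none. *)

Definition matrix_display : measure_display. Proof. exact. Qed.

Section measurable_matrix.
Context {R : realType} (m n : nat).

Definition mx_sigma : set_system 'M[R]_(m, n) :=
  <<s \bigcup_(ij in [set: 'I_m * 'I_n])
        preimage_set_system setT (fun M : 'M[R]_(m, n) => M ij.1 ij.2)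
          measurable >>.

Let mx_set0 : mx_sigma set0.
Proof. exact: sigma_algebra0. Qed.

Let mx_setC A : mx_sigma A -> mx_sigma (~` A).
Proof. exact: sigma_algebraC. Qed.

Let mx_bigcup (F : (set 'M[R]_(m, n))^nat) :
  (forall i, mx_sigma (F i)) -> mx_sigma (\bigcup_i (F i)).
Proof. exact: sigma_algebra_bigcup. Qed.

HB.instance Definition _ := @isMeasurable.Build matrix_display
  'M[R]_(m, n) mx_sigma mx_set0 mx_setC mx_bigcup.

End measurable_matrix.

Section norms.
Context {R : realType}.

Definition norm2 n (v : 'cV[R]_n) : R := Num.sqrt (\sum_i v i 0 ^+ 2).

(* The set is nonempty and bounded above, so [sup] is the true supremum. *)
Definition spectral_norm m n (M : 'M[R]_(m, n)) : R :=
  sup [set norm2 (M *m v) | v in [set v : 'cV[R]_n | norm2 v <= 1]].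

Definition frob_dot m n (M N : 'M[R]_(m, n)) : R :=
  \sum_i \sum_j M i j * N i j.

Definition frob_norm m n (M : 'M[R]_(m, n)) : R := Num.sqrt (frob_dot M M).

Definition subdifferential m n (f : 'M[R]_(m, n) -> R) (M : 'M[R]_(m, n)) :
    set 'M[R]_(m, n) :=
  [set g | forall N, f M + frob_dot g (N - M) <= f N].

End norms.

Section probability_notions.
Context {R : realType} {d : measure_display} {Omega : measurableType d}.
Variable P : probability Omega R.
Local Open Scope ereal_scope.

(* [ereal_inf] rather than the real [inf]: the norm is +oo when no s works. *)
Definition psi2_norm (X : Omega -> R) : \bar R :=
  ereal_inf [set s%:E | s in
    [set s : R | (0 < s)%R /\
                 'E_P[fun omega => expR (X omega ^+ 2 / s ^+ 2)] <= 2%:E]].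

(* Z is a version of E[X | F], for X nonnegative and F a sub-sigma-algebra
   (X need not be integrable). *)
Definition is_cond_expectation (F : set_system Omega) (X Z : Omega -> \bar R) :=
  [/\ measurable_fun [set: g_sigma_algebraType F] Z,
      forall omega, 0 <= Z omega &
      forall E, F E -> \int[P]_(omega in E) Z omega = \int[P]_(omega in E) X omega].

Definition cond_psi2_le (F : set_system Omega) (X : Omega -> R) (eta : R) :=
  exists Z : Omega -> \bar R,
    is_cond_expectation F (fun omega => (expR (X omega ^+ 2 / eta ^+ 2))%:E) Z /\
    {ae P, forall omega, Z omega <= 2%:E}.

Definition mutually_independent (I : eqType) (F : I -> set_system Omega) :=
  forall (s : seq I) (E : I -> set Omega), uniq s ->
    (forall i, i \in s -> F i (E i)) ->
    P (\big[setI/setT]_(i <- s) E i) = \prod_(i <- s) P (E i).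

(* X ~ N(0, sigma^2 I_m): the law of X is the product of m copies of
   N(0, sigma^2), stated on boxes, which determine it. *)
Definition isotropic_gaussian m (sigma : R) (X : Omega -> 'cV[R]_m) :=
  forall B : 'I_m -> set R, (forall i, measurable (B i)) ->
    P [set omega | forall i, B i (X omega i 0%R)] =
    \prod_(i < m) normal_prob 0%R sigma (B i).

End probability_notions.

Section sigma_algebras.
Context {R : realType} {d : measure_display} {Omega : measurableType d}.
Context (n m : nat).
Implicit Types (x : Omega -> 'cV[R]_n) (w : nat -> Omega -> 'cV[R]_n)
  (u : nat -> Omega -> 'cV[R]_m) (t : nat).

Definition sigma_Ft x0 w t : set_system Omega :=
  <<s g_sigma_algebra_preimage x0 `|`
      \bigcup_(s < t) g_sigma_algebra_preimage (w s) >>.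

Definition sigma_history x0 w u t : set_system Omega :=
  <<s g_sigma_algebra_preimage x0 `|`
      \bigcup_(s < t) (g_sigma_algebra_preimage (w s) `|`
                       g_sigma_algebra_preimage (u s)) >>.

Definition sigma_future {d'} {T : measurableType d'} (X : nat -> Omega -> T) t :
    set_system Omega :=
  <<s \bigcup_(s >= t) g_sigma_algebra_preimage (X s) >>.

End sigma_algebras.

Section system.
Context {R : realType} (n m r k : nat).

Definition markov_block (A : 'M[R]_n) (B : 'M[R]_(n, m)) (C : 'M[R]_(r, n))
    (D : 'M[R]_(r, m)) (j : nat) : 'M[R]_(r, m) :=
  if j is i.+1 then C *m (A ^+ i) *m B else D.

(* The width m * k of G* appears as the block dimension \sum_(i < k) m. *)
Definition markov_params (A : 'M[R]_n) (B : 'M[R]_(n, m)) (C : 'M[R]_(r, n))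
    (D : 'M[R]_(r, m)) : 'M[R]_(r, \sum_(i < k) m) :=
  \mxrow_(j < k) markov_block A B C D j.

(* U_t^(k); meaningful for t >= k - 1 only (truncated subtraction). *)
Definition stacked_input (u : nat -> 'cV[R]_m) (t : nat) :
    'cV[R]_(\sum_(i < k) m) :=
  \mxcol_(i < k) u (t - i)%N.

End system.

(* Main.v *)
Require Import Defs.
From HB Require Import structures.
From mathcomp Require Import all_boot all_order all_algebra.
From mathcomp Require Import all_classical all_reals all_analysis.
From mathcomp Require Import measurable_realfun.
From mathcomp Require Import ring lra zify.

Set Implicit Arguments.
Unset Strict Implicit.
Unset Printing Implicit Defensive.

Import Order.TTheory GRing.Theory Num.Theory.
Import numFieldNormedType.Exports.

Local Open Scope classical_set_scope.
Local Open Scope ring_scope.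

(* With D the current error, U the stacked input window and b the contribution
   of the state at the start of the window, the Polyak step gives
   |D'|^2 <= |D|^2 - kappa (2 lam phi - lam^2 |U|^2) for every lam >= 0, where
   kappa = 2 alpha - alpha^2 and phi is the excess loss: subgradients are
   bounded by |U|, and phi^2 / |g|^2 >= 2 lam phi - lam^2 |g|^2.  The window is
   free of attacks with probability 1 - q, and then phi >= |D U| - 2 |b|;
   otherwise phi >= - |D U|.  As the history, the inputs of the window and the
   attack indicators are independent, Fubini reduces the drift to
   E|D U| >= 3 sqrt 2 / 8 sigma |D| for a fixed matrix D, and lam proportional
   to |D| yields a contraction.  The Gaussian bound integrates
   1 - exp(- 4 x^2 / 3) <= 8 |x| / 9, since the Laplace transform of the square
   of a linear combination of independent Gaussians is computed one variable at
   a time by completing the square.  The constant 3 sqrt 2 / 8 is smaller than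
   sqrt (2 / pi), but the factor 1 / (2 pi) in the rate leaves room for it. *)

(** * Euclidean and spectral norms *)

(** The attacks inside a window may depend on its inputs, so their size cannot be integrated against
    [U]. It cancels from phi by the triangle inequality, and only the attack indicators survive,
    which are independent of inputs and history. The quotient phi^2 / |g|^2 couples all sources of
    randomness; its minorant is linear in phi, and with lam = c |D|, a function of the history, each
    term has the product form that Fubini requires. The bias [b] depends on the same history as [D];
    Young's inequality separates them and leaves only the second moment of the state, for which the
    correlations of an adversary are harmless. *)

Section euclidean_norms.
Context {R : realType}.

Lemma cauchy_schwarz_sum (I : finType) (a b : I -> R) :
  (\sum_i a i * b i) ^+ 2 <= (\sum_i a i ^+ 2) * (\sum_i b i ^+ 2).
Proof.
(* Lagrange's identity: this double sum is twice the difference of the two sides. *)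
have : 0 <= \sum_i \sum_j (a i * b j - a j * b i) ^+ 2.
  by apply: sumr_ge0 => i _; apply: sumr_ge0 => j _; exact: sqr_ge0.
rewrite (_ : \sum_i _ = 2 * ((\sum_i a i ^+ 2) * (\sum_i b i ^+ 2)
  - (\sum_i a i * b i) ^+ 2)); first by rewrite pmulr_rge0// subr_ge0.
have expand i j : (a i * b j - a j * b i) ^+ 2 =
    a i ^+ 2 * b j ^+ 2 + b i ^+ 2 * a j ^+ 2 - 2 * (a i * b i * (a j * b j)).
  by ring.
under eq_bigr => i _ do under eq_bigr => j _ do rewrite expand.
under eq_bigr => i _ do rewrite !big_split/= sumrN -!mulr_sumr.
rewrite !big_split/= sumrN -!mulr_sumr -!mulr_suml; ring.
Qed.

Section frobenius.
Context {m n : nat}.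
Implicit Types M N : 'M[R]_(m, n).

Lemma frob_dotC M N : frob_dot M N = frob_dot N M.
Proof. by apply: eq_bigr => i _; apply: eq_bigr => j _; rewrite mulrC. Qed.

Lemma frob_dotDl M N L : frob_dot (M + N) L = frob_dot M L + frob_dot N L.
Proof.
rewrite /frob_dot -big_split/=; apply: eq_bigr => i _.
by rewrite -big_split/=; apply: eq_bigr => j _; rewrite mxE mulrDl.
Qed.

Lemma frob_dotZl c M N : frob_dot (c *: M) N = c * frob_dot M N.
Proof.
rewrite /frob_dot mulr_sumr; apply: eq_bigr => i _.
by rewrite mulr_sumr; apply: eq_bigr => j _; rewrite mxE mulrA.
Qed.

Lemma frob_dotDr M N L : frob_dot L (M + N) = frob_dot L M + frob_dot L N.
Proof. by rewrite !(frob_dotC L) frob_dotDl. Qed.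

Lemma frob_dotZr c M N : frob_dot M (c *: N) = c * frob_dot M N.
Proof. by rewrite !(frob_dotC M) frob_dotZl. Qed.

Lemma frob_dotNr M N : frob_dot M (- N) = - frob_dot M N.
Proof. by rewrite -scaleN1r frob_dotZr mulN1r. Qed.

Lemma frob_dot_ge0 M : 0 <= frob_dot M M.
Proof. by do 2 (apply: sumr_ge0 => ? _); rewrite -expr2 sqr_ge0. Qed.

Lemma frob_norm_ge0 M : 0 <= frob_norm M. Proof. exact: sqrtr_ge0. Qed.

Lemma sqr_frob_norm M : frob_norm M ^+ 2 = frob_dot M M.
Proof. by rewrite sqr_sqrtr// frob_dot_ge0. Qed.

Lemma frob_norm_eq0 M : frob_norm M = 0 -> M = 0.
Proof.
move=> M0; have : frob_dot M M = 0 by rewrite -sqr_frob_norm M0 expr0n.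
have sq_ge0 i j : 0 <= M i j * M i j by rewrite -expr2 sqr_ge0.
move=> /eqP; rewrite psumr_eq0; last by move=> i _; apply: sumr_ge0.
move=> /allP Mi; apply/matrixP => i j; rewrite mxE.
have := Mi i (mem_index_enum _); rewrite implyTb psumr_eq0//.
by move=> /allP/(_ j (mem_index_enum _)); rewrite implyTb mulf_eq0 orbb => /eqP.
Qed.

Lemma frob_dot_le M N : frob_dot M N <= frob_norm M * frob_norm N.
Proof.
apply: le_trans (ler_norm _) _.
rewrite -(@ler_pXn2r _ 2)// ?nnegrE ?mulr_ge0 ?frob_norm_ge0//.
rewrite exprMn !sqr_frob_norm -normrX ger0_norm ?sqr_ge0//.
rewrite /frob_dot !pair_bigA/=.
have /= := cauchy_schwarz_sum (fun ij : 'I_m * 'I_n => M ij.1 ij.2)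
  (fun ij => N ij.1 ij.2).
by under [X in _ <= X * _]eq_bigr do rewrite expr2;
  under [X in _ <= _ * X]eq_bigr do rewrite expr2.
Qed.

Lemma sqr_frob_normD M N :
  frob_norm (M + N) ^+ 2 = frob_norm M ^+ 2 + 2 * frob_dot M N + frob_norm N ^+ 2.
Proof.
rewrite !sqr_frob_norm frob_dotDl !frob_dotDr (frob_dotC N M); ring.
Qed.

Lemma frob_normD M N : frob_norm (M + N) <= frob_norm M + frob_norm N.
Proof.
rewrite -(@ler_pXn2r _ 2)// ?nnegrE ?addr_ge0 ?frob_norm_ge0//.
rewrite sqr_frob_normD sqrrD -[X in _ <= _ + X + _]mulr_natl !lerD2r lerD2l ler_pM2l//.
exact: frob_dot_le.
Qed.

Lemma frob_normZ c M : frob_norm (c *: M) = `|c| * frob_norm M.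
Proof.
rewrite /frob_norm frob_dotZl frob_dotZr mulrA -expr2 sqrtrM ?sqr_ge0//.
by rewrite sqrtr_sqr.
Qed.

Lemma frob_normN M : frob_norm (- M) = frob_norm M.
Proof. by rewrite -scaleN1r frob_normZ normrN1 mul1r. Qed.

Lemma frob_norm0 : frob_norm (0 : 'M[R]_(m, n)) = 0.
Proof. by rewrite -(scale0r (0 : 'M[R]_(m, n))) frob_normZ normr0 mul0r. Qed.

End frobenius.

Lemma norm2E n (v : 'cV[R]_n) : norm2 v = frob_norm v.
Proof.
congr Num.sqrt; apply: eq_bigr => i _.
by rewrite big_ord1 -expr2; congr (v i _ ^+ 2); apply: val_inj.
Qed.

Lemma norm2_ge0 n (v : 'cV[R]_n) : 0 <= norm2 v. Proof. exact: sqrtr_ge0. Qed.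

Lemma norm2D n (v w : 'cV[R]_n) : norm2 (v + w) <= norm2 v + norm2 w.
Proof. by rewrite !norm2E frob_normD. Qed.

Lemma norm2N n (v : 'cV[R]_n) : norm2 (- v) = norm2 v.
Proof. by rewrite !norm2E frob_normN. Qed.

Lemma norm2Z n c (v : 'cV[R]_n) : norm2 (c *: v) = `|c| * norm2 v.
Proof. by rewrite !norm2E frob_normZ. Qed.

Lemma norm20 n : norm2 (0 : 'cV[R]_n) = 0.
Proof. by rewrite norm2E frob_norm0. Qed.

Lemma sqr_norm2 n (v : 'cV[R]_n) : norm2 v ^+ 2 = \sum_i v i 0 ^+ 2.
Proof. by rewrite sqr_sqrtr// sumr_ge0// => i _; rewrite sqr_ge0. Qed.

Lemma norm2_mul_frob m n (M : 'M[R]_(m, n)) (v : 'cV[R]_n) :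
  norm2 (M *m v) <= frob_norm M * norm2 v.
Proof.
rewrite -(@ler_pXn2r _ 2)// ?nnegrE ?mulr_ge0 ?frob_norm_ge0 ?norm2_ge0//.
rewrite exprMn sqr_frob_norm !sqr_norm2 mulr_suml; apply: ler_sum => i _.
rewrite mxE; under [X in _ <= X * _]eq_bigr do rewrite -expr2.
exact: cauchy_schwarz_sum.
Qed.

Section spectral.
Context {m n : nat}.
Implicit Type M : 'M[R]_(m, n).

Let image_ball M :=
  [set norm2 (M *m v) | v in [set v : 'cV[R]_n | norm2 v <= 1]].

Let image_ball_ub M : has_ubound (image_ball M).
Proof.
exists (frob_norm M) => _ [v /= v1 <-].
apply: le_trans (norm2_mul_frob _ _) _.
by rewrite ler_piMr// frob_norm_ge0.
Qed.

Lemma spectral_norm_ge0 M : 0 <= spectral_norm M.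
Proof.
by apply: (ub_le_sup (image_ball_ub M)); exists 0; rewrite /= ?mulmx0 norm20.
Qed.

Lemma norm2_mulmx M (v : 'cV[R]_n) :
  norm2 (M *m v) <= spectral_norm M * norm2 v.
Proof.
have [v0|v0] := eqVneq (norm2 v) 0.
  rewrite v0 mulr0; have -> : v = 0 by apply: frob_norm_eq0; rewrite -norm2E.
  by rewrite mulmx0 norm20.
have vp : 0 < norm2 v by rewrite lt_neqAle eq_sym v0 norm2_ge0.
rewrite -ler_pdivrMr//; apply: (ub_le_sup (image_ball_ub M)).
exists ((norm2 v)^-1 *: v) => /=.
  by rewrite norm2Z gtr0_norm ?invr_gt0// mulVf.
by rewrite -scalemxAr norm2Z gtr0_norm ?invr_gt0// mulrC.
Qed.

End spectral.
End euclidean_norms.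

(** * Independence and Fubini *)

Section independence.
Context {R : realType} {d : measure_display} {Omega : measurableType d}.
Variable P : probability Omega R.
Local Open Scope ereal_scope.

Lemma ge0_integral_mrestr (E : set Omega) (mE : measurable E)
    (f : Omega -> \bar R) : measurable_fun setT f -> (forall w, 0 <= f w) ->
  \int[mrestr P mE]_w f w = \int[P]_(w in E) f w.
Proof.
move=> mf f0; rewrite (@ge0_negligible_integral _ _ _ _ setT (~` E))//; last 2 first.
  - exact: measurableC.
  - by rewrite /= /mrestr setICl measure0.
rewrite setDE setCK setTI.
by apply: eq_measure_integral => A mA AE; rewrite /= /mrestr; congr (P _); apply/setIidPl.
Qed.

Section fubini.
Context {d1 d2 : measure_display} {T1 : measurableType d1}
  {T2 : measurableType d2}.
Variables (X : Omega -> T1) (Y : Omega -> T2) (E : set Omega).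
Hypotheses (mX : measurable_fun setT X) (mY : measurable_fun setT Y)
  (mE : measurable E).
Hypothesis indep : forall A B, measurable A -> measurable B ->
  P (X @^-1` A `&` Y @^-1` B `&` E) = P (X @^-1` A) * P (Y @^-1` B) * P E.

(** Under [P] restricted to [E], the law of (X, Y) agrees on rectangles with [P E] times the product
    of the two laws, hence everywhere by uniqueness of the product measure. Carrying [E] as a third
    factor lets the attack event be split off in the same step. *)
Lemma indep_fubini (F : T1 * T2 -> \bar R) :
  measurable_fun setT F -> (forall z, 0 <= F z) ->
  \int[P]_(w in E) F (X w, Y w) = P E * \int[P]_w \int[P]_w' F (X w, Y w').
Proof.
move=> mF F0.
pose X' : {mfun Omega >-> T1} := mfun_Sub (mem_set mX).
pose Y' : {mfun Omega >-> T2} := mfun_Sub (mem_set mY).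
have mXY : measurable_fun setT (fun w => (X w, Y w)).
  exact: measurable_fun_pair.
pose c := fine (P E).
have c0 : (0 <= c)%R by rewrite fine_ge0.
have cE : c%:E = P E by rewrite fineK// fin_num_measure.
pose m1 := mscale (NngNum c0) (distribution P X').
pose m2 := distribution P Y'.
pose m := pushforward (mrestr P mE) (fun w => (X w, Y w)).
have rect A B : measurable A -> measurable B -> m (A `*` B) = m1 A * m2 B.
  move=> mA mB; rewrite /m /m1 /m2 /mscale /pushforward /mrestr /= cE.
  by rewrite -[RHS]muleA muleC -indep.
have mF2 : measurable_fun setT (fun x => \int[m2]_y F (x, y)).
  exact: measurable_fun_fubini_tonelli_F.
rewrite -(ge0_integral_mrestr mE)//; last exact: measurableT_comp.
transitivity (\int[m]_z F z).
  by rewrite ge0_integral_pushforward.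
transitivity (\int[m1 \x m2]_z F z).
  apply: eq_measure_integral => C mC _; apply/esym.
  exact: (product_measure_unique rect).
rewrite fubini_tonelli1// /fubini_F ge0_integral_mscale//; last first.
  by move=> x _; exact: integral_ge0.
rewrite /= cE ge0_integral_distribution//; last by move=> x; exact: integral_ge0.
congr (_ * _); apply: eq_integral => w _ /=.
rewrite ge0_integral_distribution//.
exact: measurableT_comp mF (pair1_measurable _).
Qed.

End fubini.
End independence.

(** * Gaussian integrals *)

Section gaussian_integrals.
Context {R : realType}.
Local Open Scope ereal_scope.

(** Change of variables is available for the Radon-Nikodym derivative; it equals [normal_pdf] almost
    everywhere because both have the same integral over every measurable set. *)
Lemma ge0_integral_normal_prob (mu s : R) (f : R -> \bar R) :
  measurable_fun setT f -> (forall x, 0 <= f x) ->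
  \int[normal_prob mu s]_x f x =
  \int[lebesgue_measure]_x (f x * (normal_pdf mu s x)%:E).
Proof.
move=> mf f0; have dom := normal_prob_dominates mu s.
rewrite -(Radon_Nikodym_SigmaFinite.change_of_variables dom)//.
have mrn := measurable_int _ (Radon_Nikodym_SigmaFinite.f_integrable dom).
have mpdf : measurable_fun setT (fun x => (normal_pdf mu s x)%:E).
  by apply/measurable_EFinP; exact: measurable_normal_pdf.
apply: ae_eq_integral => //; [exact: emeasurable_funM..|].
apply: ae_eqe_mul2l; apply: integral_ae_eq => //.
  exact: Radon_Nikodym_SigmaFinite.f_integrable.
by move=> E _ mE; rewrite -Radon_Nikodym_SigmaFinite.f_integral.
Qed.

Lemma integral_expR_normal_prob (s l a c : R) : (0 < s)%R ->
  (0 < 1 + 2 * l * a ^+ 2 * s ^+ 2)%R ->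
  let V := (1 + 2 * l * a ^+ 2 * s ^+ 2)%R in
  \int[normal_prob 0 s]_x (expR (- l * (c + a * x) ^+ 2))%:E =
  (expR (- (l / V) * c ^+ 2) / Num.sqrt V)%:E.
Proof.
move=> s0 V0 V.
have sV0 : (0 < Num.sqrt V)%R by rewrite sqrtr_gt0.
(* Completing the square turns the integrand into a constant times the density of N(mu, tau^2),
   which integrates to 1. *)
pose tau := (s / Num.sqrt V)%R; have tau0 : (0 < tau)%R by rewrite divr_gt0.
have tau2 : (tau ^+ 2 = s ^+ 2 / V)%R by rewrite expr_div_n sqr_sqrtr// ltW.
pose mu := (- (2 * l * a * c * tau ^+ 2))%R.
have mexp : measurable_fun setT (fun x : R => (expR (- l * (c + a * x) ^+ 2))%:E).
  apply/measurable_EFinP; apply: measurableT_comp => //=.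
  apply: measurable_funM => //=; apply: measurable_funX => //=.
  by apply: measurable_funD => //=; exact: measurable_funM.
rewrite (ge0_integral_normal_prob _ _ mexp); last first.
  by move=> x; rewrite lee_fin expR_ge0.
have -> : \int[lebesgue_measure]_x
    ((expR (- l * (c + a * x) ^+ 2))%:E * (normal_pdf 0 s x)%:E) =
  \int[lebesgue_measure]_x
    ((expR (- (l / V) * c ^+ 2) / Num.sqrt V)%:E * (normal_pdf mu tau x)%:E).
  apply: eq_integral => x _; rewrite -!EFinM; congr EFin.
  rewrite !normal_pdfE ?gt_eqF//.
  have -> : (normal_peak tau = normal_peak s * Num.sqrt V)%R.
    rewrite /normal_peak -!mulrnAr !(@sqrtrM _ (_ ^+ 2)) ?sqr_ge0//.
    rewrite !sqrtr_sqr !gtr0_norm// /tau; field.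
    by rewrite !gt_eqF//= sqrtr_gt0 mulrn_wgt0// pi_gt0.
  rewrite (_ : _ / _ * _ = (normal_peak s * (expR (- (l / V) * c ^+ 2)
    * normal_fun mu tau x)))%R; last by field; rewrite gt_eqF.
  rewrite mulrCA; congr (_ * _)%R; rewrite /normal_fun -!expRD; congr expR.
  rewrite /mu tau2 -/V !(mulr2n (_ ^+ 2)) (mulr2n (_ / _)) /V; field.
  by rewrite (gt_eqF V0) gt_eqF// addr_gt0// exprn_gt0.
rewrite ge0_integralZl//; first by rewrite integral_normal_pdf mule1.
- by apply/measurable_EFinP; exact: measurable_normal_pdf.
- by move=> x _; rewrite lee_fin normal_pdf_ge0.
Qed.

End gaussian_integrals.

(** For w^2 > 3/2 the right side exceeds 1. Otherwise squaring exp(- 2 w^2 / 3) >= 1 - 2 w^2 / 3 >=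
    0 reduces the claim to a polynomial inequality whose defect is 4/9 w (w - 1)^2 (w + 2). *)
Lemma onem_expR_sqr_le {R : realType} (w : R) : 0 <= w ->
  1 - expR (- (4 / 3) * w ^+ 2) <= 8 / 9 * w.
Proof.
move=> w0; have [w2|w2] := leP (w ^+ 2) (3 / 2); last first.
  by have := expR_ge0 (- (4 / 3) * w ^+ 2); nra.
rewrite (_ : - (4 / 3) * w ^+ 2 = - (2 / 3) * w ^+ 2 + - (2 / 3) * w ^+ 2); last first.
  by field.
rewrite expRD -expr2; have := expR_ge1Dx (- (2 / 3) * w ^+ 2).
set e := expR _ => e1.
have : (1 - 2 / 3 * w ^+ 2) ^+ 2 <= e ^+ 2.
  by rewrite ler_pXn2r ?nnegrE ?expR_ge0//; lra.
have : 0 <= w * (w - 1) ^+ 2 * (w + 2) 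
  by rewrite mulr_ge0 ?addr_ge0// mulr_ge0 ?sqr_ge0.
nra.
Qed.

Section gaussian_family.
Context {R : realType} {d : measure_display} {Omega : measurableType d}.
Variables (P : probability Omega R) (I : finType) (z : I -> Omega -> R) (s : R).
Hypotheses (s0 : 0 < s) (mz : forall i, measurable_fun setT (z i)).

Let box (B : I -> set R) := [set w | forall i, B i (z i w)].

Hypothesis box_law : forall B : I -> set R, (forall i, measurable (B i)) ->
  P (box B) = (\prod_i normal_prob 0 s (B i))%E.

Let upd (B : I -> set R) j A i := if i == j then A else B i.

Let measurable_upd B j A : (forall i, measurable (B i)) -> measurable A ->
  forall i, measurable (upd B j A i).
Proof. by move=> mB mA i; rewrite /upd; case: ifP. Qed.

Let box_upd B j A : B j = setT -> box (upd B j A) = z j @^-1` A `&` box B.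
Proof.
move=> BT; apply/seteqP; split=> w /=.
  move=> Bw; split; first by have := Bw j; rewrite /upd eqxx.
  by move=> i; have := Bw i; rewrite /upd; case: eqP => // ->; rewrite BT.
by move=> [Aw Bw] i; rewrite /upd; case: eqP => // ->.
Qed.

Let measurable_preimage_z i A : measurable A -> measurable (z i @^-1` A).
Proof. by move=> mA; rewrite -[X in measurable X]setTI; exact: mz. Qed.

Let measurable_box B : (forall i, measurable (B i)) -> measurable (box B).
Proof.
move=> mB; rewrite (_ : box B = \bigcap_(i in [set: I]) z i @^-1` B i).
  by apply: fin_bigcap_measurable => // i _; exact: measurable_preimage_z.
by apply/seteqP; split => [w Bw i _|w Bw i]; exact: Bw.
Qed.

Let box_setT : box (fun=> setT) = setT.
Proof. by apply/seteqP; split. Qed.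

Let law_coord j A : measurable A -> P (z j @^-1` A) = normal_prob 0 s A.
Proof.
move=> mA; rewrite -[X in P X]setIT -box_setT -box_upd// box_law; last first.
  exact: measurable_upd.
rewrite (bigD1 j)//= /upd eqxx big1 ?mule1// => i /negbTE ->.
exact: probability_setT.
Qed.

Let box_coord j A B : measurable A -> (forall i, measurable (B i)) -> B j = setT ->
  P (z j @^-1` A `&` box B) = (P (z j @^-1` A) * P (box B))%E.
Proof.
move=> mA mB BT; rewrite law_coord// -box_upd// !box_law//; last first.
  exact: measurable_upd.
rewrite (bigD1 j)//= [in RHS](bigD1 j)//= {1}/upd eqxx BT.
rewrite [normal_prob _ _ setT]probability_setT mul1e; congr (_ * _)%E.
by apply: eq_bigr => i /negbTE ij; rewrite /upd ij.
Qed.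

Lemma ge0_integral_gaussian_coord j (f : R -> \bar R) :
  measurable_fun setT f -> (forall x, 0 <= f x)%E ->
  (\int[P]_w f (z j w) = \int[normal_prob 0 s]_x f x)%E.
Proof.
move=> mf f0.
have mzj : measurable_fun setT (z j : Omega -> measurableTypeR R) := mz j.
transitivity (\int[pushforward P (z j : Omega -> measurableTypeR R)]_y f y)%E.
  by rewrite (ge0_integral_pushforward mzj).
by apply: eq_measure_integral => A mA _; exact: law_coord.
Qed.

Variable a : I -> R.
Let S (q : seq I) w := \sum_(i <- q) a i * z i w.

Let mS q : measurable_fun setT (S q).
Proof. by apply: measurable_sum => i; exact: measurable_funM. Qed.

Let measurable_preimage_S q A : measurable A -> measurable (S q @^-1` A).
Proof. by move=> mA; rewrite -[X in measurable X]setTI; exact: mS. Qed.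

Let mlin c : measurable_fun setT (fun xy : R * R => c * xy.2 + xy.1).
Proof. by apply: measurable_funD => //; exact: measurable_funM. Qed.

(* Admitting box events in the remaining variables makes the induction close by
   [indep_fubini], without a monotone class argument for [S q]. *)
Let S_indep_box q A B : measurable A -> (forall i, measurable (B i)) ->
  {in q, forall i, B i = setT} -> uniq q ->
  P (S q @^-1` A `&` box B) = (P (S q @^-1` A) * P (box B))%E.
Proof.
elim: q A B => [|j q IH] A B mA mB BT.
  move=> _; have [A0|A0] := pselect (A 0).
    rewrite (_ : S [::] @^-1` A = setT) ?setTI ?probability_setT ?mul1e//.
    by apply/seteqP; split=> // w _ /=; rewrite /S big_nil.
  rewrite (_ : S [::] @^-1` A = set0) ?set0I ?measure0 ?mul0e//.
  by apply/seteqP; split=> // w; rewrite /S /= big_nil.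
move=> /= /andP[jq uq].
have BqT : {in q, forall i, B i = setT}.
  by move=> i iq; apply: BT; rewrite inE iq orbT.
have BjT : B j = setT by apply: BT; rewrite inE eqxx.
have indep B' : (forall i, measurable (B' i)) ->
    {in j :: q, forall i, B' i = setT} -> forall A1 A2,
    measurable A1 -> measurable A2 ->
    P (S q @^-1` A1 `&` z j @^-1` A2 `&` box B') =
    (P (S q @^-1` A1) * P (z j @^-1` A2) * P (box B'))%E.
  move=> mB' B'T A1 A2 mA1 mA2.
  have B'j : B' j = setT by apply: B'T; rewrite inE eqxx.
  rewrite -setIA -box_upd// IH//; first by rewrite box_upd// box_coord// muleA.
  - exact: measurable_upd.
  - move=> i iq; rewrite /upd ifN; first by apply: B'T; rewrite inE iq orbT.
    by apply: contraNneq jq => <-.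
pose F (xy : R * R) := (\1_A (a j * xy.2 + xy.1))%:E : \bar R.
have mF : measurable_fun setT F.
  apply/measurable_EFinP; apply: measurableT_comp (mlin (a j)) => //.
have key B' : (forall i, measurable (B' i)) ->
    {in j :: q, forall i, B' i = setT} ->
    P (S (j :: q) @^-1` A `&` box B') =
    (P (box B') * \int[P]_w \int[P]_w' F (S q w, z j w'))%E.
  move=> mB' B'T.
  rewrite -(indep_fubini (mS q) (mz j) (measurable_box mB') (indep _ mB' B'T))//.
    rewrite -integral_indic//=; last exact: measurable_preimage_S.
      apply: eq_integral => w _; rewrite /F /= !indicE.
      by congr (nat_of_bool _)%:R%:E; apply/idP/idP; rewrite !inE /S /= big_cons.
    exact: measurable_box.
  by move=> xy; rewrite /F lee_fin.
(* [key] is applied to [B] and then to the full box: the same double integral appears in both, so it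
   never has to be evaluated. *)
rewrite key// muleC; congr (_ * _)%E.
rewrite -[in RHS](setIT (_ @^-1` _)) -box_setT key//.
by rewrite box_setT probability_setT mul1e.
Qed.

Let S_coord_indep j q : uniq (j :: q) -> forall A1 A2,
  measurable A1 -> measurable A2 ->
  P (S q @^-1` A1 `&` z j @^-1` A2 `&` setT) =
  (P (S q @^-1` A1) * P (z j @^-1` A2) * P setT)%E.
Proof.
move=> /= /andP[jq uq] A1 A2 mA1 mA2.
rewrite setIT probability_setT mule1 -[z j @^-1` A2]setIT -box_setT -box_upd//.
rewrite S_indep_box//; first exact: measurable_upd.
by move=> i iq; rewrite /upd; case: eqP => // ij; rewrite -ij iq in jq.
Qed.

(** Integrating out one coordinate contributes 1 / sqrt V and replaces [l] by l / V, so [l] has to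
    vary in the induction. *)
Let laplace_sqr_S q l : uniq q -> 0 <= l ->
  (\int[P]_w (expR (- l * S q w ^+ 2))%:E =
   ((Num.sqrt (1 + 2 * l * s ^+ 2 * \sum_(i <- q) a i ^+ 2))^-1)%:E)%E.
Proof.
elim: q l => [|j q IH] l; first move=> _ l0.
  under eq_integral do rewrite /S big_nil expr0n/= mulr0 expR0.
  by rewrite integral_cst// [X in (_ * X)%E]probability_setT mul1e big_nil mulr0 addr0 sqrtr1 invr1.
move=> uq l0.
pose V := 1 + 2 * l * a j ^+ 2 * s ^+ 2.
have V0 : 0 < V by rewrite ltr_pwDl// mulr_ge0 ?sqr_ge0// mulr_ge0 ?sqr_ge0// mulr_ge0.
pose F (xy : R * R) := (expR (- l * (a j * xy.2 + xy.1) ^+ 2))%:E : \bar R.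
have mF : measurable_fun setT F.
  apply/measurable_EFinP; apply: measurableT_comp => //=.
  apply: measurable_funM => //=; apply: measurable_funX => //=.
have F0 xy : (0 <= F xy)%E by rewrite /F lee_fin expR_ge0.
have -> : (\int[P]_w (expR (- l * S (j :: q) w ^+ 2))%:E =
    \int[P]_(w in setT) F (S q w, z j w))%E.
  by apply: eq_integral => w _; rewrite /F /= /S big_cons.
rewrite (indep_fubini (mS q) (mz j) measurableT (S_coord_indep uq))//.
rewrite probability_setT mul1e.
under eq_integral => w _.
  rewrite (@ge0_integral_gaussian_coord j (fun x => F (S q w, x)))//; last first.
    exact: measurableT_comp mF (pair1_measurable _).
  rewrite /F /=; under eq_integral => x _ do rewrite addrC.
  rewrite integral_expR_normal_prob// -/V EFinM.
  over.
have l'0 : 0 <= l / V by rewrite divr_ge0// ltW.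
rewrite ge0_integralZr//; last first.
  apply/measurable_EFinP; apply: measurableT_comp => //=.
  by apply: measurable_funM => //=; apply: measurable_funX.
rewrite IH//; last by case/andP: uq.
rewrite -EFinM -invfM mulrC -sqrtrM; last exact: ltW.
rewrite big_cons; congr (_ ^-1)%:E; congr Num.sqrt.
by rewrite /V; field; rewrite gt_eqF.
Qed.

Lemma gaussian_abs_mean :
  ((3 * Num.sqrt 2 / 8 * (s * Num.sqrt (\sum_i a i ^+ 2)))%:E <=
   \int[P]_w `|\sum_i a i * z i w|%:E)%E.
Proof.
set Q := \sum_i a i ^+ 2.
have [Q0|Q0] := eqVneq Q 0.
  by rewrite Q0 sqrtr0 !mulr0 integral_ge0// => w _; rewrite lee_fin.
have Qp : 0 < Q.
  by rewrite lt_neqAle eq_sym Q0 sumr_ge0// => i _; rewrite sqr_ge0.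
pose X w := \sum_i a i * z i w.
have mX : measurable_fun setT X by exact: (mS (index_enum I)).
(* The exponent [l] below makes 1 + 2 l s^2 Q equal to 4, so that the Laplace transform is exactly
   1/2; [h] is the scale with l X^2 = 4/3 (X / h)^2. The mean of |X| is then at least 9/8 h / 2,
   which is the stated constant. *)
pose h := 2 * Num.sqrt 2 / 3 * (s * Num.sqrt Q).
have sq2 : Num.sqrt 2 ^+ 2 = 2 :> R by rewrite sqr_sqrtr.
have sqQ : Num.sqrt Q ^+ 2 = Q by rewrite sqr_sqrtr// ltW.
have h0 : 0 < h by rewrite !mulr_gt0 ?sqrtr_gt0.
pose l := 3 / (2 * (s ^+ 2 * Q)).
have l0 : 0 <= l by rewrite divr_ge0// !mulr_ge0 ?sqr_ge0// ltW.
have pointwise w : 9 / 8 * h <= `|X w| + 9 / 8 * h * expR (- l * X w ^+ 2).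
  have := @onem_expR_sqr_le R (`|X w| / h) (divr_ge0 (normr_ge0 _) (ltW h0)).
  rewrite (_ : - (4 / 3) * _ = - l * X w ^+ 2); last first.
    rewrite expr_div_n real_normK ?num_real// /h !exprMn exprVn sq2 sqQ /l.
    by field; rewrite !gt_eqF.
  set e := expR _; rewrite mulrA ler_pdivlMr//; lra.
have mexp : measurable_fun setT (fun w => (expR (- l * X w ^+ 2))%:E).
  apply/measurable_EFinP; apply: measurableT_comp => //=.
  by apply: measurable_funM => //=; exact: measurable_funX.
have h98 : 0 <= 9 / 8 * h by rewrite mulr_ge0 ?divr_ge0// ltW.
have mean_exp : (\int[P]_w (expR (- l * X w ^+ 2))%:E = (1 / 2)%:E)%E.
  rewrite (@laplace_sqr_S (index_enum I) l) ?index_enum_uniq//.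
  congr (_%:E); rewrite div1r; congr (_ ^-1).
  rewrite (_ : 1 + _ = 2 ^+ 2) ?sqrtr_sqr ?ger0_norm//.
  by rewrite -/Q /l; field; rewrite !gt_eqF.
have mabs : measurable_fun setT (fun w => `|X w|%:E : \bar R).
  by apply/measurable_EFinP; exact: measurableT_comp.
have : ((9 / 8 * h)%:E <=
    \int[P]_w (`|X w|%:E + (9 / 8 * h)%:E * (expR (- l * X w ^+ 2))%:E))%E.
  rewrite -[leLHS]mule1 -(@probability_setT _ _ _ P) -integral_cst//.
  apply: ge0_le_integral => //.
  - by apply: emeasurable_funD => //; exact: measurable_funeM.
  - by move=> w _; rewrite -EFinM -EFinD lee_fin.
rewrite ge0_integralD//; last 2 first.
  - by move=> w _; rewrite -EFinM lee_fin mulr_ge0// expR_ge0.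
  - exact: measurable_funeM.
rewrite ge0_integralZl// mean_exp -EFinM -leeBlDr// -EFinB.
apply: le_trans; rewrite lee_fin /h; lra.
Qed.

End gaussian_family.

(** For 0 < t < 1 the exponential moment with 2 l s^2 = 1 - t^2 equals 1 / t, and exp y >= 1 + y
    bounds the second moment by 2 s^2 / (t (1 + t)), which tends to s^2 as t tends to 1. *)
Lemma normal_prob_second_moment {R : realType} (s : R) : 0 < s ->
  (\int[normal_prob 0 s]_x (x ^+ 2)%:E <= (s ^+ 2)%:E)%E.
Proof.
move=> s0; set e := (\int[_]_x _)%E.
have e0 : (0 <= e)%E by apply: integral_ge0 => x _; rewrite lee_fin sqr_ge0.
have bound t : 0 < t < 1 -> (1 + ((1 - t ^+ 2) / (2 * s ^+ 2))%:E * e <= t^-1%:E)%E.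
  move=> /andP[t0 t1]; set l := (1 - t ^+ 2) / (2 * s ^+ 2).
  have l0 : 0 <= l by rewrite divr_ge0 ?mulr_ge0 ?sqr_ge0//; nra.
  have V : 1 + 2 * (- l) * 1 ^+ 2 * s ^+ 2 = t ^+ 2.
    by rewrite /l; field; rewrite gt_eqF.
  have := @integral_expR_normal_prob R s (- l) 1 0 s0.
  rewrite V exprn_gt0// => /(_ isT); rewrite expr0n/= mulr0 expR0 sqrtr_sqr.
  rewrite gtr0_norm// div1r => <-.
  have m2 : measurable_fun setT (fun x : R => (x ^+ 2)%:E).
    by apply/measurable_EFinP; exact: measurable_funX.
  rewrite -ge0_integralZl//; last by move=> x _; rewrite lee_fin sqr_ge0.
  rewrite -[X in (X + _)%E](@probability_setT _ _ _ (normal_prob 0 s)).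
  rewrite -[X in (X + _)%E]mul1e -integral_cst// -ge0_integralD//; last 2 first.
    by move=> x _; rewrite -EFinM lee_fin mulr_ge0 ?sqr_ge0.
    exact: measurable_funeM.
  apply: ge0_le_integral => //.
  - by move=> x _; rewrite -EFinM -EFinD lee_fin addr_ge0// mulr_ge0// sqr_ge0.
  - by apply: emeasurable_funD => //; exact: measurable_funeM.
  - apply/measurable_EFinP; apply: measurableT_comp => //=.
    apply: measurable_funM => //=; apply: measurable_funX => //=.
    by apply: measurable_funD => //=; exact: measurable_funM.
  - move=> x _; rewrite -EFinM -EFinD lee_fin opprK add0r mul1r.
    exact: expR_ge1Dx.
have : e \is a fin_num.
  (* One value of t already shows that the moment is finite, which the real arithmetic below
     requires. *)
  have : (0 < (2 : R)^-1 < 1) by lra.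
  move=> /bound; rewrite ge0_fin_numE//; case: (e) e0 => [r||]//= _.
    by move=> _; exact: ltry.
  rewrite gt0_muley ?addey//; rewrite lte_fin divr_gt0 ?mulr_gt0 ?exprn_gt0//.
  by lra.
move=> /fineK; set r := fine e => er; rewrite -er lee_fin leNgt.
apply/negP => rs; have s20 : 0 < s ^+ 2 by rewrite exprn_gt0.
have r0 : 0 < r by exact: lt_trans rs.
set y := s ^+ 2 / r; have y01 : 0 < y < 1.
  by rewrite divr_gt0//= ltr_pdivrMr// mul1r.
(* If the moment r exceeded s^2 = y r, the midpoint t of y and 1 would violate the bound, since t (1
   + t) - 2 y = (y - 1) (y - 3) / 4 > 0. *)
have t01 : 0 < (1 + y) / 2 < 1 by lra.
set t := (1 + y) / 2 in t01; have := bound _ t01.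
rewrite -er -EFinM -EFinD lee_fin; apply/negP; rewrite -ltNge.
have /andP[t0 t1] := t01; have /andP[y0 y1] := y01.
rewrite -[t^-1]mul1r ltr_pdivrMr//.
have -> : s ^+ 2 = y * r by rewrite /y divfK// gt_eqF.
have -> : (1 + (1 - t ^+ 2) / (2 * (y * r)) * r) * t =
  1 + (1 - t) * (t * (1 + t) - 2 * y) / (2 * y).
  by field; rewrite !gt_eqF.
rewrite ltrDl divr_gt0 ?mulr_gt0 ?subr_gt0 ?invr_gt0//.
have : 0 < (y - 1) * (y - 3) by rewrite nmulr_rgt0 subr_lt0//; lra.
by rewrite /t; lra.
Qed.

(** * Random matrices and vectors *)

Section measurable_matrices.
Context {R : realType} {d : measure_display} {T : measurableType d}.

Lemma measurable_mx_coord m n (f : T -> 'M[R]_(m, n)) i j :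
  measurable_fun setT f -> measurable_fun setT (fun w => f w i j).
Proof.
move=> mf; apply: (measurableT_comp _ mf (f := fun M : 'M[R]_(m, n) => M i j)).
move=> _ A mA; apply: sub_sigma_algebra.
by exists (i, j) => //; exists A.
Qed.

Lemma measurable_mx m n (f : T -> 'M[R]_(m, n)) :
  (forall i j, measurable_fun setT (fun w => f w i j)) -> measurable_fun setT f.
Proof.
move=> mf; apply: (measurability _ (erefl (@measurable _ 'M[R]_(m, n)))).
move=> _ [A [[i j] _ [B mB <-]] <-].
rewrite !setTI; have := mf i j measurableT B mB; rewrite setTI; exact.
Qed.

Lemma measurable_mulmx m n p (f : T -> 'M[R]_(m, n)) (g : T -> 'M[R]_(n, p)) :
  measurable_fun setT f -> measurable_fun setT g ->
  measurable_fun setT (fun w => f w *m g w).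
Proof.
move=> mf mg; apply: measurable_mx => i j.
under eq_fun do rewrite mxE.
apply: measurable_sum => k.
by apply: measurable_funM; exact: measurable_mx_coord.
Qed.

Lemma measurable_addmx m n (f g : T -> 'M[R]_(m, n)) :
  measurable_fun setT f -> measurable_fun setT g ->
  measurable_fun setT (fun w => f w + g w).
Proof.
move=> mf mg; apply: measurable_mx => i j.
under eq_fun do rewrite mxE.
by apply: measurable_funD; exact: measurable_mx_coord.
Qed.

Lemma measurable_summx m n (I : finType) (f : I -> T -> 'M[R]_(m, n)) :
  (forall i, measurable_fun setT (f i)) ->
  measurable_fun setT (fun w => \sum_i f i w).
Proof.
move=> mf; apply: measurable_mx => i j.
under eq_fun do rewrite summxE.
by apply: measurable_sum => k; exact: measurable_mx_coord.
Qed.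

Lemma measurable_scalemx m n (a : T -> R) (g : T -> 'M[R]_(m, n)) :
  measurable_fun setT a -> measurable_fun setT g ->
  measurable_fun setT (fun w => a w *: g w).
Proof.
move=> mf mg; apply: measurable_mx => i j.
under eq_fun do rewrite mxE.
by apply: measurable_funM => //; exact: measurable_mx_coord.
Qed.

Lemma measurable_oppmx m n (g : T -> 'M[R]_(m, n)) :
  measurable_fun setT g -> measurable_fun setT (fun w => - g w).
Proof.
move=> mg; under eq_fun do rewrite -scaleN1r.
exact: measurable_scalemx.
Qed.

Lemma measurable_frob_norm m n (f : T -> 'M[R]_(m, n)) :
  measurable_fun setT f -> measurable_fun setT (fun w => frob_norm (f w)).
Proof.
move=> mf; apply: (measurableT_comp (f := @Num.sqrt R)).
  by apply: continuous_measurable_fun; exact: sqrt_continuous.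
apply: measurable_sum => i; apply: measurable_sum => j.
by apply: measurable_funM; exact: measurable_mx_coord.
Qed.

Lemma measurable_norm2 n (f : T -> 'cV[R]_n) :
  measurable_fun setT f -> measurable_fun setT (fun w => norm2 (f w)).
Proof.
by move=> mf; under eq_fun do rewrite norm2E; exact: measurable_frob_norm.
Qed.

End measurable_matrices.

Section isotropic_gaussian_vectors.
Context {R : realType} {d : measure_display} {Omega : measurableType d}.
Variables (P : probability Omega R) (N : nat) (V : Omega -> 'cV[R]_N) (s : R).
Hypotheses (s0 : 0 < s) (mV : measurable_fun setT V)
  (law : isotropic_gaussian P s V).

(** The extra factor |M| reduces vectors to scalars: by Cauchy-Schwarz |M| |M V| dominates the sum
    over the rows M_i of |M_i| |M_i V|, and each row contributes a multiple of |M_i|^2. *)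
Lemma gaussian_mulmx_mean r (M : 'M[R]_(r, N)) :
  ((3 * Num.sqrt 2 / 8 * s * frob_norm M ^+ 2)%:E <=
   \int[P]_w (frob_norm M * norm2 (M *m V w))%:E)%E.
Proof.
pose rowsq i := \sum_j M i j ^+ 2.
have rowsq0 i : 0 <= rowsq i by apply: sumr_ge0 => j _; exact: sqr_ge0.
have frobE : frob_norm M ^+ 2 = \sum_i rowsq i.
  by rewrite sqr_frob_norm; apply: eq_bigr => i _; apply: eq_bigr => j _; rewrite expr2.
have mz i : measurable_fun setT (fun w => V w i 0) by exact: measurable_mx_coord.
have mrow i : measurable_fun setT (fun w => `|\sum_j M i j * V w j 0|).
  apply: measurableT_comp => //; apply: measurable_sum => j.
  exact: measurable_funM.
have pointwise w :
    \sum_i Num.sqrt (rowsq i) * `|\sum_j M i j * V w j 0| <=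
    frob_norm M * norm2 (M *m V w).
  rewrite -(@ler_pXn2r _ 2)// ?nnegrE ?mulr_ge0 ?frob_norm_ge0 ?norm2_ge0//; last first.
    by apply: sumr_ge0 => i _; rewrite mulr_ge0 ?sqrtr_ge0.
  rewrite exprMn frobE sqr_norm2; apply: le_trans (cauchy_schwarz_sum _ _) _.
  under eq_bigr do rewrite sqr_sqrtr//.
  rewrite ler_wpM2l ?sumr_ge0//; apply: ler_sum => i _.
  by rewrite mxE real_normK// num_real.
apply: (@le_trans _ _ (\int[P]_w
    (\sum_i Num.sqrt (rowsq i) * `|\sum_j M i j * V w j 0|)%:E)%E); last first.
  apply: ge0_le_integral => //.
  - move=> w _; rewrite lee_fin; apply: sumr_ge0 => i _.
    by rewrite mulr_ge0 ?sqrtr_ge0.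
  - by apply/measurable_EFinP; apply: measurable_sum => i; exact: measurable_funM.
  - apply/measurable_EFinP; apply: measurable_funM => //; apply: measurable_norm2.
    exact: measurable_mulmx.
  - by move=> w _; rewrite lee_fin; exact: pointwise.
under eq_integral do rewrite -sumEFin.
rewrite ge0_integral_sum//; last first.
- by move=> i; apply/measurable_EFinP; exact: measurable_funM.
rewrite frobE mulr_sumr -sumEFin; apply: lee_sum => i _.
under eq_integral do rewrite EFinM.
rewrite ge0_integralZl//; last exact/measurable_EFinP.
have := gaussian_abs_mean s0 mz law (M i).
rewrite -/(rowsq i) => /(lee_wpmul2l _) - /(_ (Num.sqrt (rowsq i))%:E).
rewrite lee_fin sqrtr_ge0 => /(_ isT); apply: le_trans.
rewrite -EFinM lee_fin -[X in _ * X <= _](sqr_sqrtr (rowsq0 i)).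
by rewrite le_eqVlt; apply/orP; left; apply/eqP; ring.
Qed.

Lemma gaussian_sqr_norm2_mean :
  (\int[P]_w (norm2 (V w) ^+ 2)%:E <= (N%:R * s ^+ 2)%:E)%E.
Proof.
have mz i : measurable_fun setT (fun w => V w i 0) by exact: measurable_mx_coord.
under eq_integral do rewrite sqr_norm2 -sumEFin.
rewrite ge0_integral_sum//; last 2 first.
- by move=> i; apply/measurable_EFinP; exact: measurable_funX.
- by move=> i w _; rewrite lee_fin sqr_ge0.
rewrite mulr_natl -[N in _ *+ N]card_ord -sumr_const -sumEFin.
apply: lee_sum => i _.
rewrite (ge0_integral_gaussian_coord mz law i (f := fun x => (x ^+ 2)%:E)).
- exact: normal_prob_second_moment.
- by apply/measurable_EFinP; exact: measurable_funX.
- by move=> x; rewrite lee_fin sqr_ge0.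
Qed.

End isotropic_gaussian_vectors.

(** * One step of the method *)

Lemma polyak_step {R : realType} (m n : nat) (f : 'M[R]_(m, n) -> R)
    (G Gs g : 'M[R]_(m, n)) (alpha gamma U lam : R) :
  let theta := Num.max ((f G - f Gs) / frob_norm g ^+ 2) 0 in
  g != 0 -> subdifferential f G g ->
  f (G + g) <= f G + frob_norm g * U ->
  0 < alpha <= 1 -> alpha * theta <= gamma <= (2 - alpha) * theta -> 0 <= lam ->
  frob_norm (G - gamma *: g - Gs) ^+ 2 <= frob_norm (G - Gs) ^+ 2
    - (2 * alpha - alpha ^+ 2) * (2 * lam * (f G - f Gs) - lam ^+ 2 * U ^+ 2).
Proof.
move=> theta gn0 sub lip /andP[a0 a1] /andP[gam1 gam2] lam0.
pose ng := frob_norm g; rewrite -/ng in lip.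
have ng0 : 0 < ng.
  rewrite lt_neqAle frob_norm_ge0 andbT eq_sym.
  by apply: contra gn0 => /eqP /frob_norm_eq0 ->.
(* The subgradient inequality tested at G + g gives |g|^2 <= f (G + g) - f G <= |g| U. *)
have ngU : ng <= U.
  have := sub (G + g); rewrite addrAC subrr add0r -sqr_frob_norm -/ng => /le_trans.
  by move=> /(_ _ lip); rewrite lerD2l expr2 ler_pM2l.
have key : f G - f Gs <= frob_dot g (G - Gs).
  have := sub Gs; rewrite -opprB frob_dotNr; lra.
have -> : frob_norm (G - gamma *: g - Gs) ^+ 2 =
    frob_norm (G - Gs) ^+ 2 - 2 * gamma * frob_dot g (G - Gs) + gamma ^+ 2 * ng ^+ 2.
  have -> : G - gamma *: g - Gs = (G - Gs) + - (gamma *: g) by rewrite addrAC.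
  rewrite [LHS]sqr_frob_normD frob_normN frob_normZ exprMn real_normK ?num_real//.
  by rewrite frob_dotNr frob_dotZr (frob_dotC _ g) -/ng; ring.
have k0 : 0 <= 2 * alpha - alpha ^+ 2 by nra.
have U2 : ng ^+ 2 <= U ^+ 2 by rewrite !expr2 ler_pM// ltW.
pose phi := f G - f Gs; rewrite -/phi in key *.
(* With no excess loss the step size is forced to be 0, and the bracket multiplied by 2 alpha -
   alpha^2 is nonpositive. *)
have [phi0|phi0] := leP phi 0.
  have th0 : theta = 0.
    by apply/max_idPr; rewrite -/phi -/ng pmulr_lle0 ?invr_gt0 ?exprn_gt0.
  have -> : gamma = 0 by apply: le_anti; move: gam1 gam2; rewrite th0 !mulr0 => -> ->.
  rewrite mulr0 mul0r expr0n/= mul0r subr0 addr0 lerDl oppr_ge0 mulr_ge0_le0//.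
  have : 0 <= lam ^+ 2 * U ^+ 2 by rewrite mulr_ge0 ?sqr_ge0.
  have : 2 * lam * phi <= 0 by rewrite mulr_ge0_le0// mulr_ge0.
  lra.
have thE : theta = phi / ng ^+ 2.
  by apply/max_idPl; rewrite -/phi -/ng divr_ge0 ?sqr_ge0// ltW.
have phiE : phi = theta * ng ^+ 2 by rewrite thE divfK// gt_eqF// exprn_gt0.
have th0 : 0 < theta by rewrite thE divr_gt0// exprn_gt0.
have gam0 : 0 <= gamma by apply: le_trans gam1; rewrite mulr_ge0 ?ltW.
(* A quadratic in gamma is at most its value at the endpoints alpha theta and (2 - alpha) theta,
   where it takes the same value. *)
have step1 : gamma ^+ 2 - 2 * gamma * theta <=
    - (2 * alpha - alpha ^+ 2) * theta ^+ 2.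
  have : 0 <= (gamma - alpha * theta) * ((2 - alpha) * theta - gamma).
    by rewrite mulr_ge0// subr_ge0.
  nra.
have step2 : 2 * lam * phi - lam ^+ 2 * U ^+ 2 <= theta ^+ 2 * ng ^+ 2.
  rewrite phiE; have : 0 <= (theta - lam) ^+ 2 * ng ^+ 2 by rewrite mulr_ge0 ?sqr_ge0.
  have : lam ^+ 2 * ng ^+ 2 <= lam ^+ 2 * U ^+ 2 by rewrite ler_wpM2l ?sqr_ge0.
  lra.
have := ler_wpM2l k0 step2.
have := ler_wpM2r (sqr_ge0 ng) step1.
have : gamma * (theta * ng ^+ 2) <= gamma * frob_dot g (G - Gs).
  by rewrite ler_wpM2l// -phiE.
lra.
Qed.

(** * Expected contraction over one window *)

Section contraction.
Context {R : realType} {d : measure_display} {Omega : measurableType d}.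
Variables (P : probability Omega R) (r N : nat).
Variables (D D' : Omega -> 'M[R]_(r, N)) (U : Omega -> 'cV[R]_N)
  (b : Omega -> 'cV[R]_r) (E : set Omega) (s q kap beta eps : R).
Hypotheses (N0 : (0 < N)%N) (s0 : 0 < s) (q0 : 0 <= q) (q2 : q < 1 / 2)
  (kap0 : 0 <= kap) (kap1 : kap <= 1).
Hypotheses (mD : measurable_fun setT D) (mD' : measurable_fun setT D')
  (mU : measurable_fun setT U) (mb : measurable_fun setT b) (mE : measurable E).
Hypothesis lawU : isotropic_gaussian P s U.
Hypothesis PE : P E = (1 - q)%:E.
Hypothesis indep : forall A B F, measurable A -> measurable B ->
  F = E \/ F = ~` E ->
  P (D @^-1` A `&` U @^-1` B `&` F) = (P (D @^-1` A) * P (U @^-1` B) * P F)%E.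
(** The quantifier over [lam] lies inside the almost sure statement because [lam] will be chosen as
    a function of the outcome. The difference of indicators is the sign with which |D U| enters. *)
Hypothesis step : {ae P, forall w, forall lam, 0 <= lam ->
  frob_norm (D' w) ^+ 2 <= frob_norm (D w) ^+ 2 -
    kap * (2 * lam * ((\1_E w - \1_(~` E) w) * norm2 (D w *m U w)
                      - 2 * norm2 (b w)) - lam ^+ 2 * norm2 (U w) ^+ 2)}.
Hypothesis mean_b : (\int[P]_w (norm2 (b w) ^+ 2)%:E <= beta%:E)%E.
Hypothesis mean_D : (\int[P]_w (frob_norm (D w) ^+ 2)%:E <= eps%:E)%E.

(** The lower bound on the mean of |D U| involves the true second moment, not its bound [eps]; the
    exchange for [eps] comes last, where the coefficient 1 - rate is nonnegative. *)
Let e := fine (\int[P]_w (frob_norm (D w) ^+ 2)%:E)%E.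

Let mfrob (X : Omega -> 'M[R]_(r, N)) : measurable_fun setT X ->
  measurable_fun setT (fun w => (frob_norm (X w) ^+ 2)%:E).
Proof.
by move=> mX; apply/measurable_EFinP/measurable_funX; exact: measurable_frob_norm.
Qed.

Let eE : (\int[P]_w (frob_norm (D w) ^+ 2)%:E = e%:E)%E.
Proof.
rewrite fineK// ge0_fin_numE; first exact: le_lt_trans mean_D (ltry _).
by apply: integral_ge0 => w _; rewrite lee_fin sqr_ge0.
Qed.

Let e0 : 0 <= e.
Proof. by rewrite fine_ge0// integral_ge0// => w _; rewrite lee_fin sqr_ge0. Qed.

Let J (z : 'M[R]_(r, N) * 'cV[R]_N) := frob_norm z.1 * norm2 (z.1 *m z.2).

Let mJ : measurable_fun setT J.
Proof.
apply: measurable_funM; first exact: measurable_frob_norm.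
by apply: measurable_norm2; exact: measurable_mulmx.
Qed.

Let J0 z : 0 <= J z. Proof. by rewrite mulr_ge0 ?frob_norm_ge0 ?norm2_ge0. Qed.

Let PCE : P (~` E) = q%:E.
Proof. by rewrite probability_setC// PE -EFinB opprB addrC subrK. Qed.

(** Independence without the third event follows by adding the identities for [E] and its
    complement. *)
Let indepT A B : measurable A -> measurable B ->
  P (D @^-1` A `&` U @^-1` B `&` setT) = (P (D @^-1` A) * P (U @^-1` B) * P setT)%E.
Proof.
move=> mA mB.
have mDA : measurable (D @^-1` A) by rewrite -[X in measurable X]setTI; exact: mD.
have mUB : measurable (U @^-1` B) by rewrite -[X in measurable X]setTI; exact: mU.
have mDU := measurableI _ _ mDA mUB.
have split_E : P (D @^-1` A `&` U @^-1` B) =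
    (P (D @^-1` A `&` U @^-1` B `&` E) + P (D @^-1` A `&` U @^-1` B `&` ~` E))%E.
  rewrite -measureU; first by rewrite -setIUr setUv setIT.
  - exact: measurableI.
  - by apply: measurableI => //; exact: measurableC.
  - by rewrite setIACA setICr setI0.
rewrite setIT split_E !indep//; [|by right|by left].
have q1 : 0 <= 1 - q by have := q2; lra.
rewrite probability_setT mule1 PE PCE -ge0_muleDr ?lee_fin//.
by rewrite -EFinD subrK mule1.
Qed.

Let meanJ := (\int[P]_w \int[P]_w' (J (D w, U w'))%:E)%E.

Let mmeanJ : measurable_fun setT (fun w => \int[P]_w' (J (D w, U w'))%:E)%E.
Proof.
pose U' : {mfun Omega >-> 'cV[R]_N} := mfun_Sub (mem_set mU).
have mEJ : measurable_fun setT (EFin \o J) by exact/measurable_EFinP.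
rewrite (_ : (fun w => _) =
  (fun M => \int[distribution P U']_v (EFin \o J) (M, v))%E \o D).
  by apply: measurableT_comp mD; exact: measurable_fun_fubini_tonelli_F.
apply/funext => w /=; rewrite ge0_integral_distribution//.
  exact: measurableT_comp mEJ (pair1_measurable _).
by move=> v; rewrite lee_fin J0.
Qed.

Let meanJ_ge : ((3 * Num.sqrt 2 / 8 * s * e)%:E <= meanJ)%E.
Proof.
have c0 : 0 <= 3 * Num.sqrt 2 / 8 * s.
  by rewrite mulr_ge0 ?divr_ge0 ?mulr_ge0 ?sqrtr_ge0// ltW.
rewrite EFinM -eE -ge0_integralZl//; last 2 first.
- exact: mfrob.
- by move=> w _; rewrite lee_fin sqr_ge0.
apply: ge0_le_integral => //.
- by move=> w _; rewrite -EFinM lee_fin mulr_ge0 ?sqr_ge0.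
- by apply: measurable_funeM; exact: mfrob.
- by move=> w _; rewrite -EFinM; exact: gaussian_mulmx_mean.
Qed.

Let mnorm2 (n : nat) (X : Omega -> 'cV[R]_n) : measurable_fun setT X ->
  measurable_fun setT (fun w => (norm2 (X w) ^+ 2)%:E).
Proof.
by move=> mX; apply/measurable_EFinP/measurable_funX; exact: measurable_norm2.
Qed.

Let Ns0 : 0 <= N%:R * s ^+ 2. Proof. by rewrite mulr_ge0 ?sqr_ge0. Qed.

(** Finiteness is what permits moving this mean across the integrated inequality. It comes from |D|
    |D U| <= |D|^2 |U| and |U| <= 1 + |U|^2. *)
Let meanJ_lty : (meanJ < +oo)%E.
Proof.
apply: (@le_lt_trans _ _ (e * (1 + N%:R * s ^+ 2))%:E); last exact: ltry.
rewrite EFinM -eE -ge0_integralZr//; last 3 first.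
- exact: mfrob.
- by move=> w _; rewrite lee_fin sqr_ge0.
- by rewrite lee_fin addr_ge0.
apply: ge0_le_integral => //.
- by move=> w _; apply: integral_ge0 => w' _; rewrite lee_fin J0.
- by apply: emeasurable_funM => //; exact: mfrob.
move=> w _; apply: (@le_trans _ _ (\int[P]_w'
    ((frob_norm (D w) ^+ 2)%:E * (1 + (norm2 (U w') ^+ 2)%:E)))%E).
  apply: ge0_le_integral => //.
  - by move=> w' _; rewrite lee_fin J0.
  - apply/measurable_EFinP.
    exact: measurableT_comp (measurableT_comp mJ (pair1_measurable (D w))) mU.
  - by apply: measurable_funeM; apply: emeasurable_funD => //; exact: mnorm2.
  - move=> w' _; rewrite -EFinD -EFinM lee_fin /J /=.
    apply: le_trans (ler_wpM2l (frob_norm_ge0 _) (norm2_mul_frob _ _)) _.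
    rewrite mulrA -expr2 ler_wpM2l ?sqr_ge0//.
    have := sqr_ge0 (norm2 (U w') - 1); have := norm2_ge0 (U w'); nra.
rewrite ge0_integralZl//; last 3 first.
- by apply: emeasurable_funD => //; exact: mnorm2.
- by move=> w' _; rewrite -EFinD lee_fin addr_ge0 ?sqr_ge0.
- by rewrite lee_fin sqr_ge0.
rewrite lee_wpmul2l ?lee_fin ?sqr_ge0// ge0_integralD//; last 2 first.
- by move=> w' _; rewrite lee_fin sqr_ge0.
- exact: mnorm2.
rewrite integral_cst// [X in (_ * X)%E]probability_setT mul1e EFinD.
by rewrite leeD2l//; exact: gaussian_sqr_norm2_mean.
Qed.

Let mean_DU : (\int[P]_w (frob_norm (D w) ^+ 2 * norm2 (U w) ^+ 2)%:E <=
  (e * (N%:R * s ^+ 2))%:E)%E.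
Proof.
pose F (z : 'M[R]_(r, N) * 'cV[R]_N) := (frob_norm z.1 ^+ 2 * norm2 z.2 ^+ 2)%:E : \bar R.
have mF : measurable_fun setT F.
  apply/measurable_EFinP; apply: measurable_funM; apply: measurable_funX.
    exact: measurable_frob_norm.
  exact: measurable_norm2.
have F0 z : (0 <= F z)%E by rewrite lee_fin mulr_ge0 ?sqr_ge0.
rewrite -[leLHS]/(\int[P]_(w in setT) F (D w, U w))%E.
rewrite (indep_fubini mD mU measurableT indepT)//.
rewrite probability_setT mul1e EFinM -eE -ge0_integralZr//; last 2 first.
- exact: mfrob.
- by move=> w _; rewrite lee_fin sqr_ge0.
apply: ge0_le_integral => //.
- by move=> w _; exact: integral_ge0.
- rewrite (_ : (fun w => _) = (fun w => (frob_norm (D w) ^+ 2)%:E *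
      \int[P]_w' (norm2 (U w') ^+ 2)%:E)%E); last first.
    apply/funext => w; rewrite -ge0_integralZl//; last 3 first.
    + exact: mnorm2.
    + by move=> w' _; rewrite lee_fin sqr_ge0.
    + by rewrite lee_fin sqr_ge0.
  by apply: emeasurable_funM => //; exact: mfrob.
- by apply: emeasurable_funM => //; exact: mfrob.
move=> w _; under eq_integral do rewrite /F /= EFinM.
rewrite ge0_integralZl//; last 3 first.
- exact: mnorm2.
- by move=> w' _; rewrite lee_fin sqr_ge0.
- by rewrite lee_fin sqr_ge0.
rewrite lee_wpmul2l ?lee_fin ?sqr_ge0//; exact: gaussian_sqr_norm2_mean.
Qed.

Let integral_JE F : measurable F -> (forall A B, measurable A -> measurable B ->
    P (D @^-1` A `&` U @^-1` B `&` F) = (P (D @^-1` A) * P (U @^-1` B) * P F)%E) ->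
  (\int[P]_w (\1_F w * J (D w, U w))%:E = P F * meanJ)%E.
Proof.
move=> mF indepF.
rewrite -(@indep_fubini _ _ _ P _ _ _ _ _ _ _ mD mU mF indepF (EFin \o J)).
- rewrite [RHS]integral_mkcond epatch_indic; apply: eq_integral => w _.
  by rewrite /= EFinM muleC.
- exact/measurable_EFinP.
- by move=> z; rewrite lee_fin J0.
Qed.

(* The step [lam = c |D|] minimises the bound up to the loss of a factor
   [8/9] that pays for the cross term with [b]. *)
Lemma contraction_step :
  (\int[P]_w (frob_norm (D' w) ^+ 2)%:E <=
   ((1 - (1 - 2 * q) ^+ 2 * kap / (2 * pi * N%:R)) * eps
    + kap * 36 / (N%:R * s ^+ 2) * beta)%:E)%E.
Proof.
have Np : 0 < N%:R :> R by rewrite ltr0n.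
pose kapG : R := 3 * Num.sqrt 2 / 8.
have kapG2 : kapG ^+ 2 = 9 / 32.
  by rewrite /kapG !exprMn exprVn sqr_sqrtr//; field.
have kapG0 : 0 <= kapG by rewrite divr_ge0 ?mulr_ge0 ?sqrtr_ge0.
pose a := (1 - 2 * q) * kapG; pose c := a / (N%:R * s).
have q1 : 0 <= 1 - 2 * q by have := q2; lra.
have a0 : 0 <= a by rewrite mulr_ge0.
have c0 : 0 <= c by apply: divr_ge0 => //; rewrite mulr_ge0// ltW.
(* Weights of Young's inequality for 4 c |D| |b|, the defect being (a |D| / 3 - 6 |b| / s)^2 / N.
   Here [y1] is a ninth of the gain a^2 / N. *)
pose y1 := a ^+ 2 / (9 * N%:R); pose y2 := 36 / (N%:R * s ^+ 2).
pose c1 := 1 + kap * y1; pose c2 := kap * y2.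
pose c3 := 2 * kap * c.
pose c4 := kap * c ^+ 2.
have c10 : 0 <= c1.
  by rewrite addr_ge0// mulr_ge0// divr_ge0 ?sqr_ge0// mulr_ge0.
have c20 : 0 <= c2 by rewrite mulr_ge0// divr_ge0// mulr_ge0 ?sqr_ge0.
have c30 : 0 <= c3 by rewrite mulr_ge0// mulr_ge0.
have c40 : 0 <= c4 by rewrite mulr_ge0 ?sqr_ge0.
have JJ w : J (D w, U w) = frob_norm (D w) * norm2 (D w *m U w) by [].
(* The gain on [E] stands on the left and the loss on its complement on the right, so that both
   sides are sums of nonnegative terms and integrate termwise. *)
have pointwise : {ae P, forall w,
    frob_norm (D' w) ^+ 2 + c3 * (\1_E w * J (D w, U w)) <=
    c1 * frob_norm (D w) ^+ 2 + c2 * norm2 (b w) ^+ 2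
    + c3 * (\1_(~` E) w * J (D w, U w))
    + c4 * (frob_norm (D w) ^+ 2 * norm2 (U w) ^+ 2)}.
  have := step; apply: filterS => w /(_ (c * frob_norm (D w))).
  have D0 := frob_norm_ge0 (D w).
  move=> /(_ (mulr_ge0 c0 D0)) h; rewrite JJ.
  move: h; set x := frob_norm (D w) => h.
  have young : 4 * c * x * norm2 (b w) <= y1 * x ^+ 2 + y2 * norm2 (b w) ^+ 2.
    rewrite -subr_ge0 (_ : _ - _ = (a * x / 3 - 6 * norm2 (b w) / s) ^+ 2 / N%:R).
      by rewrite divr_ge0 ?sqr_ge0.
    by rewrite /c /y1 /y2; field; rewrite !gt_eqF.
  have := ler_wpM2l kap0 young; rewrite /c1 /c2 /c3 /c4; move: h; lra.
have mdD := mfrob mD; have mdD' := mfrob mD'.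
have mIJ F : measurable F ->
    measurable_fun setT (fun w => (\1_F w * J (D w, U w))%:E).
  move=> mF; apply/measurable_EFinP; apply: measurable_funM => //.
  by apply: measurableT_comp mJ _; exact: measurable_fun_pair.
have mDU : measurable_fun setT
    (fun w => (frob_norm (D w) ^+ 2 * norm2 (U w) ^+ 2)%:E).
  by under eq_fun do rewrite EFinM; apply: emeasurable_funM => //; exact: mnorm2.
have mCE := measurableC mE.
have IJ0 F w : (0 <= (\1_F w * J (D w, U w))%:E)%E.
  by rewrite lee_fin mulr_ge0.
have mb2 := mnorm2 mb.
have mT1 := measurable_funeM c1%:E mdD.
have mT2 := measurable_funeM c2%:E mb2.
have mT3 F (mF : measurable F) := measurable_funeM c3%:E (mIJ F mF).
have mT4 := measurable_funeM c4%:E mDU.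
have DU0 w : (0 <= (frob_norm (D w) ^+ 2 * norm2 (U w) ^+ 2)%:E)%E.
  by rewrite lee_fin mulr_ge0 ?sqr_ge0.
have D0 (X : Omega -> 'M[R]_(r, N)) w : (0 <= (frob_norm (X w) ^+ 2)%:E)%E.
  by rewrite lee_fin sqr_ge0.
have b0 w : (0 <= (norm2 (b w) ^+ 2)%:E)%E by rewrite lee_fin sqr_ge0.
have : (\int[P]_w ((frob_norm (D' w) ^+ 2)%:E + c3%:E * (\1_E w * J (D w, U w))%:E)
    <= \int[P]_w (c1%:E * (frob_norm (D w) ^+ 2)%:E + c2%:E * (norm2 (b w) ^+ 2)%:E
    + c3%:E * (\1_(~` E) w * J (D w, U w))%:E
    + c4%:E * (frob_norm (D w) ^+ 2 * norm2 (U w) ^+ 2)%:E))%E.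
  apply: ae_ge0_le_integral => //.
  - by move=> w _; rewrite adde_ge0 ?mule_ge0.
  - by apply: emeasurable_funD => //; exact: mT3.
  - by move=> w _; rewrite !adde_ge0 ?mule_ge0.
  - apply: emeasurable_funD => //; apply: emeasurable_funD; last exact: mT3.
    exact: emeasurable_funD.
  - by apply: filterS pointwise => w + _; rewrite -!EFinM -!EFinD lee_fin.
rewrite ge0_integralD//; last 2 first.
- by move=> w _; rewrite mule_ge0.
- exact: mT3.
rewrite ge0_integralZl//; last exact: mIJ.
rewrite ge0_integralD//; last 3 first.
- by move=> w _; rewrite !adde_ge0 ?mule_ge0.
- by apply: emeasurable_funD; [exact: emeasurable_funD|exact: mT3].
- by move=> w _; rewrite mule_ge0.
rewrite ge0_integralD//; last 4 first.
- by move=> w _; rewrite adde_ge0 ?mule_ge0.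
- exact: emeasurable_funD.
- by move=> w _; rewrite mule_ge0.
- exact: mT3.
rewrite ge0_integralD//; last 2 first.
- by move=> w _; rewrite mule_ge0.
- by move=> w _; rewrite mule_ge0.
rewrite !ge0_integralZl//; last exact: mIJ.
rewrite eE !integral_JE//; last 2 first.
- by move=> A B mA mB; apply: indep => //; right.
- by move=> A B mA mB; apply: indep => //; left.
pose j := fine meanJ.
have jE : meanJ = j%:E.
  rewrite fineK// ge0_fin_numE//; apply: integral_ge0 => w _.
  by apply: integral_ge0 => w' _; rewrite lee_fin.
rewrite PE PCE jE -!EFinM => h.
have {h} : (\int[P]_w (frob_norm (D' w) ^+ 2)%:E + (c3 * ((1 - q) * j))%:E <=
    (c1 * e + c2 * beta + c3 * (q * j) + c4 * (e * (N%:R * s ^+ 2)))%:E)%E.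
  apply: le_trans h _; rewrite 3!EFinD (EFinM c2) (EFinM c4).
  by rewrite leeD// ?leeD2r// ?leeD2l// lee_wpmul2l.
rewrite -leeBrDr// -EFinB => /le_trans; apply; rewrite lee_fin.
have je : kapG * s * e <= j by have := meanJ_ge; rewrite -/meanJ jE lee_fin.
have c3q0 : 0 <= c3 * (1 - 2 * q) by rewrite mulr_ge0.
have := ler_wpM2l c3q0 je.
have -> : c3 * (1 - 2 * q) * (kapG * s * e) = 2 * kap * a ^+ 2 / N%:R * e.
  by rewrite /c3 /c /a; field; rewrite !gt_eqF.
have -> : c4 * (e * (N%:R * s ^+ 2)) = kap * a ^+ 2 / N%:R * e.
  by rewrite /c4 /c; field; rewrite !gt_eqF.
have a2 : a ^+ 2 = (1 - 2 * q) ^+ 2 * (9 / 32) by rewrite /a exprMn kapG2.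
have pi0 := pi_gt0 R; have pi2 := pi_ge2 R.
pose rate := (1 - 2 * q) ^+ 2 * kap / (2 * pi * N%:R).
(* The argument yields the contraction rate on the right, as 8/9 of kap a^2 / N with a^2 = 9/32 (1 -
   2 q)^2; the claimed rate is smaller since pi >= 2. *)
have rate_le : rate <= (1 - 2 * q) ^+ 2 * kap / (4 * N%:R).
  rewrite ler_wpM2l ?mulr_ge0 ?sqr_ge0// lef_pV2 ?posrE ?mulr_gt0//.
  by rewrite ler_wpM2r ?(ltW Np)//; move: pi2; lra.
have rate1 : rate <= 1.
  apply: le_trans rate_le _; rewrite ler_pdivrMr ?mulr_gt0// mul1r.
  have N1 : 1 <= N%:R :> R by rewrite ler1n.
  have sq1 : (1 - 2 * q) ^+ 2 <= 1 by apply: exprn_ile1 => //; have := q0; lra.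
  have := mulr_ile1 (sqr_ge0 (1 - 2 * q)) kap0 sq1 kap1; lra.
have ee : e <= eps by rewrite -lee_fin -eE.
have r1 : 0 <= 1 - rate by rewrite subr_ge0.
have := ler_wpM2l r1 ee.
have := ler_wpM2r e0 rate_le.
have -> : (1 - 2 * q) ^+ 2 * kap / (4 * N%:R) * e = 8 / 9 * (kap * a ^+ 2 / N%:R * e).
  by rewrite a2; field; rewrite gt_eqF.
rewrite -/rate -/y2 (_ : kap * 36 / _ * beta = c2 * beta); last first.
  by rewrite /c2 /y2; field; rewrite !gt_eqF.
have -> : c1 * e = e + 1 / 9 * (kap * a ^+ 2 / N%:R * e).
  by rewrite /c1 /y1; field; rewrite gt_eqF.
lra.
Qed.

End contraction.

(** * Input windows, psi_2 moments and attacks *)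

Section stacked_inputs.
Context {R : realType} {d : measure_display} {Omega : measurableType d}.
Variable P : probability Omega R.

Lemma stacked_inputE m k (u : nat -> 'cV[R]_m) T x :
  stacked_input k u T x 0 = u (T - tagnat.sig1 x)%N (tagnat.sig2 x) 0.
Proof. by rewrite /stacked_input /mxcol mxE. Qed.

(** The condition on [T] keeps the truncated subtraction T - i injective for i < k; otherwise the
    window would repeat the input at time 0. *)
Lemma isotropic_gaussian_stacked m k T (s : R) (u : nat -> Omega -> 'cV[R]_m) :
  (k <= T.+1)%N -> (forall t, isotropic_gaussian P s (u t)) ->
  mutually_independent P (fun t => g_sigma_algebra_preimage (u t)) ->
  isotropic_gaussian P s (fun w => stacked_input k (fun t => u t w) T).
Proof.
move=> kT law indep B mB.
(* Quantifying over ordinals equal to [i] makes the constraint meaningful for every natural number: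
   for i >= k it is vacuous. *)
pose C (i : nat) := [set v : 'cV[R]_m |
  forall (i' : 'I_k) j, i = i' -> B (tagnat.Rank i' j) (v j 0)].
have mC i : measurable (C i).
  rewrite (_ : C i = \bigcap_(z in [set z : 'I_k * 'I_m | i = z.1])
      ((fun v : 'cV[R]_m => v z.2 0) @^-1` B (tagnat.Rank z.1 z.2))); last first.
    apply/seteqP; split=> [v Cv [i' j] /= ii'|v Cv i' j ii'].
      exact: Cv.
    exact: (Cv (i', j)).
  apply: fin_bigcap_measurable => [|z _]; first exact: finite_finset.
  rewrite -[X in measurable X]setTI.
  by apply: (measurable_mx_coord _ _ (@measurable_id _ _ setT)).
pose E t := u t @^-1` C (T - t)%N.
pose idx := [seq (T - i)%N | i <- iota 0 k].
have idx_le i : i \in iota 0 k -> (T - (T - i) = i)%N.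
  by rewrite mem_iota => ik; rewrite subKn//; lia.
have uidx : uniq idx.
  by rewrite map_inj_in_uniq ?iota_uniq// => i j /idx_le {2}<- /idx_le {2}<- ->.
rewrite (_ : [set _ | _] = \big[setI/setT]_(t <- idx) E t); last first.
  rewrite -bigcap_seq; apply/seteqP; split=> [w Bw t /= /mapP[i /idx_le Ti ->]|].
    rewrite /E /preimage /= Ti => i' j ii'.
    have := Bw (tagnat.Rank i' j); rewrite stacked_inputE tagnat.Rank1K -ii'.
    by congr (B _ (u _ w _ 0)); apply: val_inj; rewrite tagnat.Rank2K.
  move=> w Ew x; rewrite stacked_inputE -[x in B x]tagnat.sig2K.
  have xk : (tagnat.sig1 x : nat) \in iota 0 k by rewrite mem_iota/=.
  have /= := Ew (T - tagnat.sig1 x)%N.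
  by rewrite /E map_f// idx_le// => /(_ isT); apply.
rewrite (indep idx E uidx); last first.
  by move=> t _; exists (C (T - t)%N); rewrite ?setTI.
rewrite big_map -[k in iota 0 k]subn0 big_mkord.
rewrite [RHS](reindex tagnat.rank); last exact: tagnat.rank_bij_on.
transitivity (\prod_(i < k) \prod_(j < m) normal_prob 0 s (B (tagnat.Rank i j)))%E;
  last by rewrite sig_big_dep; apply: eq_bigr => -[].
apply: eq_bigr => i _; rewrite /E idx_le; last by rewrite mem_iota /=.
rewrite -(law (T - i)%N (fun j => B (tagnat.Rank i j)))//.
congr (P _); apply/seteqP; split=> w /= Cw => [j|i' j /ord_inj <-]; exact: Cw.
Qed.

End stacked_inputs.

Section moments.
Context {R : realType} {d : measure_display} {Omega : measurableType d}.
Variable P : probability Omega R.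

(** Integrate 1 + X^2 / s^2 <= exp (X^2 / s^2). *)
Lemma exp_moment_mean (X : Omega -> R) (s : R) : measurable_fun setT X -> 0 < s ->
  (\int[P]_w (expR (X w ^+ 2 / s ^+ 2))%:E <= 2%:E)%E ->
  (\int[P]_w (X w ^+ 2)%:E <= (s ^+ 2)%:E)%E.
Proof.
move=> mX s0 h; have s20 : 0 < s ^+ 2 by rewrite exprn_gt0.
have mX2 : measurable_fun setT (fun w => (X w ^+ 2)%:E).
  by apply/measurable_EFinP; exact: measurable_funX.
have : (\int[P]_w (1 + (s ^- 2)%:E * (X w ^+ 2)%:E) <= 2%:E)%E.
  apply: le_trans h; apply: ge0_le_integral => //.
  - by move=> w _; rewrite -EFinM -EFinD lee_fin addr_ge0// mulr_ge0 ?invr_ge0 ?sqr_ge0.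
  - by apply: emeasurable_funD => //; exact: measurable_funeM.
  - apply/measurable_EFinP; apply: measurableT_comp => //.
    by apply: measurable_funM => //; exact: measurable_funX.
  - move=> w _; rewrite -EFinM -EFinD lee_fin mulrC; exact: expR_ge1Dx.
rewrite ge0_integralD//; last 2 first.
- by move=> w _; rewrite -EFinM lee_fin mulr_ge0 ?invr_ge0 ?sqr_ge0.
- exact: measurable_funeM.
rewrite integral_cst// [X in (_ * X)%E]probability_setT mul1e.
rewrite -leeBrDl// -EFinB (_ : 2 - 1 = 1); last by ring.
rewrite ge0_integralZl//; last 2 first.
- by move=> w _; rewrite lee_fin sqr_ge0.
- by rewrite lee_fin invr_ge0 sqr_ge0.
by rewrite lee_pdivrMl// mule1.
Qed.

Lemma psi2_norm_mean (X : Omega -> R) (eta : R) : measurable_fun setT X -> 0 < eta ->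
  (psi2_norm P X <= eta%:E)%E -> (\int[P]_w (X w ^+ 2)%:E <= (4 * eta ^+ 2)%:E)%E.
Proof.
move=> mX eta0 h.
(* The norm is an infimum, so an admissible s is extracted below 2 eta rather than at eta; this is
   the source of the factor 4. *)
have : (psi2_norm P X < (2 * eta)%:E)%E.
  by apply: le_lt_trans h _; rewrite lte_fin; lra.
move=> /ereal_inf_lt[_ [s [s0 hs] <-]]; rewrite lte_fin => s2.
rewrite unlock in hs.
apply: le_trans (exp_moment_mean mX s0 hs) _; rewrite lee_fin.
nra.
Qed.

Lemma cond_psi2_mean (F : set_system Omega) (X : Omega -> R) (eta : R) :
  F setT -> <<s F>> `<=` measurable ->
  measurable_fun setT X -> 0 < eta -> cond_psi2_le P F X eta ->
  (\int[P]_w (X w ^+ 2)%:E <= (eta ^+ 2)%:E)%E.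
Proof.
move=> FT Fm mX eta0 [Z [[mZ Z0 ZE] Z2]]; apply: exp_moment_mean => //.
have mZ' : measurable_fun (setT : set Omega) Z.
  move=> _ A mA; apply: Fm; exact: (mZ measurableT A mA).
rewrite -ZE// -[leRHS]mule1 -(@probability_setT _ _ _ P) -integral_cst//.
apply: ae_ge0_le_integral => //.
- by move=> w _; rewrite lee_fin.
- by apply: filterS Z2.
Qed.

Lemma prob_no_attack (xi : nat -> {RV P >-> bool}) (p : R) t l : 0 <= p <= 1 ->
  (forall t E, distribution P (xi t) E = bernoulli_prob p E) ->
  mutually_independent P (fun t => g_sigma_algebra_preimage (xi t)) ->
  P (\big[setI/setT]_(j < l) (xi (t + j)%N @^-1` [set false])) =
  ((1 - p) ^+ l)%:E.
Proof.
move=> p01 law indep.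
have law0 s : P (xi s @^-1` [set false]) = (1 - p)%:E.
  have := law s [set false]; rewrite /distribution /pushforward => ->.
  rewrite bernoulli_probE// !diracE (mem_set (erefl : [set false] false)).
  by rewrite (@memNset _ _ true)// mule0 mule1 add0e.
have uidx : uniq [seq (t + j)%N | j <- iota 0 l].
  by rewrite map_inj_uniq ?iota_uniq//; exact: addnI.
have := indep _ (fun s => xi s @^-1` [set false]) uidx.
rewrite !big_map -[l in iota 0 l]subn0 !big_mkord => ->.
  by rewrite (eq_bigr _ (fun i _ => law0 _)) prodEFin prodr_const card_ord.
by move=> s _; exists [set false]; rewrite ?setTI.
Qed.

End moments.

(** * State dynamics and generated sigma-algebras *)

Section dynamics.
Context {R : realType} {n m r : nat}.
Variables (A : 'M[R]_n) (B : 'M[R]_(n, m)) (C : 'M[R]_(r, n)) (D : 'M[R]_(r, m)).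
Variables (x w : nat -> 'cV[R]_n) (u : nat -> 'cV[R]_m).
Hypothesis state_eq : forall t, x t.+1 = A *m x t + B *m u t + w t.

Lemma state_unroll t l : x (t + l)%N = A ^+ l *m x t +
  \sum_(j < l) A ^+ (l - j.+1) *m (B *m u (t + j)%N + w (t + j)%N).
Proof.
elim: l => [|l IH]; first by rewrite addn0 big_ord0 addr0 expr0 mul1mx.
rewrite addnS state_eq IH mulmxDr mulmxA mulmx_sumr exprS -mulmxE -!addrA.
congr (_ + _); rewrite big_ord_recr/= subnn expr0 mul1mx; congr (_ + _).
apply: eq_bigr => j _.
by rewrite mulmxA subSS -[in RHS](subnSK (ltn_ord j)) exprS -mulmxE.
Qed.

(** The output at t + l sees only the attacks at t, ..., t + l - 1. A window of k = l + 1 inputs is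
    thus exposed to k - 1 attack times, hence the exponent in q. *)
Lemma output_decomposition t l (y : nat -> 'cV[R]_r) :
  (forall t, y t = C *m x t + D *m u t) ->
  y (t + l)%N = markov_params l.+1 A B C D *m stacked_input l.+1 u (t + l)
    + C *m (A ^+ l *m x t)
    + \sum_(j < l) C *m (A ^+ (l - j.+1) *m w (t + j)%N).
Proof.
move=> ->; rewrite state_unroll /markov_params /stacked_input mul_mxrow_mxcol.
rewrite big_ord_recl/= subn0 mulmxDr mulmx_sumr.
rewrite [X in _ + X + _ + _](reindex_inj rev_ord_inj)/=.
under eq_bigr => j _ do rewrite mulmxDr mulmxDr.
rewrite big_split/= [LHS]addrC -!addrA; congr (_ + _).
rewrite [LHS]addrCA; congr (_ + (_ + _)); apply: eq_bigr => j _.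
rewrite /bump/= add1n !mulmxA; congr (_ *m u _).
by have := ltn_ord j; lia.
Qed.

End dynamics.

Section state_moments.
Context {R : realType}.

Lemma norm2_sum n (I : finType) (v : I -> 'cV[R]_n) :
  norm2 (\sum_i v i) <= \sum_i norm2 (v i).
Proof.
elim/big_rec2: _ => [|i a b _ h]; first by rewrite norm20.
by apply: le_trans (norm2D _ _) _; rewrite lerD2l.
Qed.

Lemma geometric_sum_le (rho : R) t : 0 <= rho < 1 ->
  \sum_(i < t.+1) rho ^+ (t - i) <= (1 - rho)^-1.
Proof.
move=> /andP[r0 r1]; rewrite (reindex_inj rev_ord_inj)/=.
under eq_bigr => i _ do rewrite subSS subKn -1?ltnS//.
rewrite -[leRHS]mul1r ler_pdivlMr ?subr_gt0// mulrC.
rewrite -opprB mulNr -subrX1 opprB lerBlDr lerDl exprn_ge0//.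
Qed.

(** Cauchy-Schwarz with each weight rho^(t - i) split into two square roots. The bound is pathwise,
    so arbitrarily correlated disturbances enter only through second moments. *)
Lemma sqr_norm2_geometric_le n (A : 'M[R]_n) (psi rho : R) t (z : nat -> 'cV[R]_n) :
  0 <= psi -> 0 <= rho < 1 ->
  (forall l : nat, spectral_norm (A ^+ l) <= psi * rho ^+ l) ->
  norm2 (\sum_(i < t.+1) A ^+ (t - i) *m z i) ^+ 2 <=
  psi ^+ 2 / (1 - rho) * \sum_(i < t.+1) rho ^+ (t - i) * norm2 (z i) ^+ 2.
Proof.
move=> psi0 rho01 hA; have /andP[r0 r1] := rho01.
have rt i : 0 <= rho ^+ i by rewrite exprn_ge0.
pose c i := Num.sqrt (rho ^+ i).
have c2 i : c i ^+ 2 = rho ^+ i by rewrite sqr_sqrtr.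
have : norm2 (\sum_(i < t.+1) A ^+ (t - i) *m z i) <=
    psi * \sum_(i < t.+1) c (t - i)%N * (c (t - i)%N * norm2 (z i)).
  apply: le_trans (norm2_sum _) _; rewrite mulr_sumr; apply: ler_sum => i _.
  rewrite (_ : psi * _ = psi * rho ^+ (t - i) * norm2 (z i)); last first.
    by rewrite -c2; ring.
  by apply: le_trans (norm2_mulmx _ _) _; rewrite ler_wpM2r ?norm2_ge0.
rewrite -(@ler_pXn2r _ 2)// ?nnegrE ?norm2_ge0//; last first.
  rewrite mulr_ge0// sumr_ge0// => i _.
  by rewrite mulr_ge0 ?sqrtr_ge0// mulr_ge0 ?sqrtr_ge0 ?norm2_ge0.
move=> /le_trans; apply; rewrite exprMn -mulrA ler_wpM2l ?sqr_ge0//.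
apply: le_trans (cauchy_schwarz_sum _ _) _.
under eq_bigr do rewrite c2.
under [X in _ * X]eq_bigr do rewrite exprMn c2.
rewrite ler_wpM2r ?geometric_sum_le// sumr_ge0// => i _.
by rewrite mulr_ge0 ?sqr_ge0.
Qed.

Context {d : measure_display} {Omega : measurableType d}.
Variable P : probability Omega R.

Lemma mean_sqr_norm2_geometric n (A : 'M[R]_n) (psi rho M : R) t
    (z : nat -> Omega -> 'cV[R]_n) : 0 <= psi -> 0 <= rho < 1 -> 0 <= M ->
  (forall l : nat, spectral_norm (A ^+ l) <= psi * rho ^+ l) ->
  (forall i, measurable_fun setT (z i)) ->
  (forall i, (\int[P]_w (norm2 (z i w) ^+ 2)%:E <= M%:E)%E) ->
  (\int[P]_w (norm2 (\sum_(i < t.+1) A ^+ (t - i) *m z i w) ^+ 2)%:E <=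
   (psi ^+ 2 * M / (1 - rho) ^+ 2)%:E)%E.
Proof.
move=> psi0 rho01 M0 hA mz zM; have /andP[r0 r1] := rho01.
have mz2 i : measurable_fun setT (fun w => (norm2 (z i w) ^+ 2)%:E).
  by apply/measurable_EFinP/measurable_funX; exact: measurable_norm2.
have rt i : 0 <= rho ^+ i by rewrite exprn_ge0.
have K0 : 0 <= psi ^+ 2 / (1 - rho) by rewrite divr_ge0 ?sqr_ge0// subr_ge0 ltW.
apply: (@le_trans _ _ (\int[P]_w ((psi ^+ 2 / (1 - rho))%:E *
    (\sum_(i < t.+1) (rho ^+ (t - i))%:E * (norm2 (z i w) ^+ 2)%:E)))%E).
  apply: ge0_le_integral => //.
  - by move=> w _; rewrite lee_fin sqr_ge0.
  - apply/measurable_EFinP/measurable_funX/measurable_norm2.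
    by apply: measurable_summx => i; exact: measurable_mulmx.
  - apply: measurable_funeM; apply: emeasurable_sum => i.
    exact: measurable_funeM.
  - move=> w _; under [X in (_ <= _ * X)%E]eq_bigr do rewrite -EFinM.
    rewrite sumEFin -EFinM lee_fin.
    exact: (@sqr_norm2_geometric_le _ _ _ _ _ (fun i => z i w)).
rewrite ge0_integralZl//; last 2 first.
- by apply: emeasurable_sum => i; exact: measurable_funeM.
- by move=> w _; apply: sume_ge0 => i _; rewrite -EFinM lee_fin mulr_ge0 ?sqr_ge0.
rewrite ge0_integral_sum//; last 2 first.
- by move=> i; exact: measurable_funeM.
- by move=> i w _; rewrite -EFinM lee_fin mulr_ge0 ?sqr_ge0.
apply: (@le_trans _ _ ((psi ^+ 2 / (1 - rho))%:E *
    \sum_(i < t.+1) (rho ^+ (t - i))%:E * M%:E))%E.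
  apply: lee_wpmul2l => //; apply: lee_sum => i _.
  rewrite ge0_integralZl//; last 2 first.
  - by move=> w _; rewrite lee_fin sqr_ge0.
  - by rewrite lee_fin.
  by rewrite lee_wpmul2l ?lee_fin.
under eq_bigr do rewrite -EFinM.
rewrite sumEFin -EFinM lee_fin -mulr_suml.
rewrite (_ : psi ^+ 2 * M / _ = psi ^+ 2 / (1 - rho) * ((1 - rho)^-1 * M)).
  by rewrite ler_wpM2l// ler_wpM2r// geometric_sum_le.
by field; rewrite gt_eqF// subr_gt0.
Qed.

End state_moments.

Section generated_sigma_algebras.
Context {d d' : measure_display} {Omega : measurableType d} {T : measurableType d'}.
Implicit Types (F : set_system Omega) (f : Omega -> T).

Lemma measurable_generator F f : g_sigma_algebra_preimage f `<=` F ->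
  measurable_fun (setT : set (g_sigma_algebraType F)) f.
Proof.
move=> fF _ A mA; apply: sub_gen_smallest; apply: fF.
by exists A.
Qed.

Lemma measurable_sub_generator F F' f : F `<=` F' ->
  measurable_fun (setT : set (g_sigma_algebraType F)) f ->
  measurable_fun (setT : set (g_sigma_algebraType F')) f.
Proof.
move=> FF' mf _ A mA; apply: (sub_sigma_algebra2 FF').
exact: mf measurableT A mA.
Qed.

Lemma measurable_from_generator F f : F `<=` measurable ->
  measurable_fun (setT : set (g_sigma_algebraType F)) f ->
  measurable_fun (setT : set Omega) f.
Proof.
move=> Fm mf _ A mA; have := mf measurableT A mA.
apply: smallest_sub => //; exact: sigma_algebra_measurable.
Qed.

Lemma preimage_generator F f A : measurable A ->
  measurable_fun (setT : set (g_sigma_algebraType F)) f -> <<s F>> (f @^-1` A).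
Proof. by move=> mA mf; have := mf measurableT A mA; rewrite setTI. Qed.

End generated_sigma_algebras.

(** * The system and the algorithm *)

Section system_identification.
Context {R : realType} {n m r l : nat} {d : measure_display}
  {Omega : measurableType d}.
Variables (A : 'M[R]_n) (B : 'M[R]_(n, m)) (C : 'M[R]_(r, n)) (D : 'M[R]_(r, m)).
Variables (P : probability Omega R) (x0 : {RV P >-> 'cV[R]_n})
  (u : nat -> {RV P >-> 'cV[R]_m}) (w : nat -> {RV P >-> 'cV[R]_n})
  (xi : nat -> {RV P >-> bool})
  (x : nat -> Omega -> 'cV[R]_n) (y : nat -> Omega -> 'cV[R]_r).
Hypotheses (hx0 : forall omega, x 0%N omega = x0 omega)
  (hx : forall t omega,
    x t.+1 omega = A *m x t omega + B *m u t omega + w t omega)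
  (hy : forall t omega, y t omega = C *m x t omega + D *m u t omega).

Let history t : set_system Omega := g_sigma_algebra_preimage x0 `|`
  \bigcup_(s < t) (g_sigma_algebra_preimage (w s) `|` g_sigma_algebra_preimage (u s)).

(** Measurability is relative to the generated sigma-algebra viewed as a space of its own, so the
    closure lemmas for random matrices apply unchanged. *)
Let history_measurable t (d' : measure_display) (T : measurableType d')
    (f : Omega -> T) :=
  measurable_fun (setT : set (g_sigma_algebraType (history t))) f.

Let history_leq s t : (s <= t)%N -> history s `<=` history t.
Proof.
move=> st; apply: setUS; apply: bigcup_subset => i /=.
by move=> /leq_trans; apply.
Qed.

Let history_w s t : (s < t)%N -> history_measurable t (w s).
Proof.
move=> st; apply: measurable_generator => F hF.
by right; exists s => //; left.
Qed.

Let history_u s t : (s < t)%N -> history_measurable t (u s).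
Proof.
move=> st; apply: measurable_generator => F hF.
by right; exists s => //; right.
Qed.

Let history_x s t : (s <= t)%N -> history_measurable t (x s).
Proof.
elim: s => [|s IH] st.
  rewrite (_ : x 0%N = x0); last by apply/funext => om; rewrite hx0.
  by apply: measurable_generator => F hF; left.
rewrite (_ : x s.+1 = (fun om => A *m x s om + B *m u s om + w s om)); last first.
  by apply/funext => om; rewrite hx.
apply: measurable_addmx; last exact: history_w.
apply: measurable_addmx; apply: measurable_mulmx => //.
  exact: IH (ltnW st).
exact: history_u.
Qed.

Let history_y s t : (s < t)%N -> history_measurable t (y s).
Proof.
move=> st; rewrite (_ : y s = (fun om => C *m x s om + D *m u s om)); last first.
  by apply/funext => om; rewrite hy.
apply: measurable_addmx; apply: measurable_mulmx => //.
  exact: history_x (ltnW st).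
exact: history_u.
Qed.

Let U t omega := stacked_input l.+1 (fun s => u s omega) t.

Let history_U s t : (s < t)%N -> history_measurable t (U s).
Proof.
move=> st; apply: measurable_mx => i j; rewrite (ord1 j).
rewrite (_ : (fun om => _) =
  (fun om => u (s - tagnat.sig1 i)%N om (tagnat.sig2 i) 0)); last first.
  by apply/funext => om; rewrite /U stacked_inputE.
apply: measurable_mx_coord; apply: history_u.
by apply: leq_ltn_trans st; exact: leq_subr.
Qed.

Let history_sub t : history t `<=` measurable.
Proof.
move=> F [|[s _ []]] [Z mZ <-]; rewrite setTI -[X in measurable X]setTI;
  exact: measurable_funPT.
Qed.

Let measurable_x t : measurable_fun setT (x t).
Proof. exact: measurable_from_generator (@history_sub t) (history_x (leqnn t)). Qed.

Let measurable_U t : measurable_fun setT (U t).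
Proof.
exact: measurable_from_generator (@history_sub t.+1) (history_U (ltnSn t)).
Qed.

Section moments.
Variables (rho psi eta sigma : R).
Hypotheses (psi0 : 0 < psi) (hrho : 0 <= rho < 1)
  (hA : forall t : nat, spectral_norm (A ^+ t) <= psi * rho ^+ t)
  (heta : 0 < eta)
  (hx0_psi2 : (psi2_norm P (fun omega => norm2 (x0 omega)) <= eta%:E)%E)
  (hw_psi2 : forall t, cond_psi2_le P (sigma_Ft x0 w t)
                           (fun omega => norm2 (w t omega)) eta)
  (hsigma : 0 < sigma)
  (hu_law : forall t, isotropic_gaussian P sigma (u t)).

(** One bound for two kinds of terms: 4 eta^2 for the initial state, and twice the sum of the second
    moments for [B u + w]. *)
Let M := 4 * (eta ^+ 2 + spectral_norm B ^+ 2 * (m%:R * sigma ^+ 2)).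

Let mean_w t : (\int[P]_om (norm2 (w t om) ^+ 2)%:E <= (eta ^+ 2)%:E)%E.
Proof.
apply: cond_psi2_mean (hw_psi2 t) => //.
- exact: (@measurableT _ (g_sigma_algebraType _)).
- apply: smallest_sub; first exact: sigma_algebra_measurable.
  apply: smallest_sub; first exact: sigma_algebra_measurable.
  move=> F [|[s _]] [Z mZ <-]; rewrite setTI -[X in measurable X]setTI;
    exact: measurable_funPT.
- exact: measurable_norm2.
Qed.

Let mean_x t : (\int[P]_om (norm2 (x t om) ^+ 2)%:E <=
  (psi ^+ 2 * M / (1 - rho) ^+ 2)%:E)%E.
Proof.
(* Shifting the index by one absorbs the initial state, so that the state is a single convolution
   with the powers of [A]. *)
pose z i om := if i is j.+1 then B *m u j om + w j om else x0 om.
have xz om : x t om = \sum_(i < t.+1) A ^+ (t - i) *m z i om.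
  have := state_unroll (fun s => hx s om) 0 t; rewrite !add0n => ->.
  by rewrite big_ord_recl /= subn0 hx0.
under eq_integral do rewrite xz.
have B0 : 0 <= spectral_norm B ^+ 2 * (m%:R * sigma ^+ 2).
  by rewrite mulr_ge0 ?sqr_ge0// mulr_ge0 ?sqr_ge0.
have M0 : 0 <= M by rewrite mulr_ge0// addr_ge0 ?sqr_ge0.
have mBu j : measurable_fun setT (fun om => B *m u j om).
  by apply: measurable_mulmx => //.
apply: mean_sqr_norm2_geometric => //; first exact: ltW.
  case=> [|j]; first exact: measurable_funPT.
  exact: measurable_addmx.
have msq k (v : Omega -> 'cV[R]_k) : measurable_fun setT v ->
    measurable_fun setT (fun om => (norm2 (v om) ^+ 2)%:E).
  by move=> mv; apply/measurable_EFinP/measurable_funX; exact: measurable_norm2.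
case=> [|j] /=.
  apply: le_trans (psi2_norm_mean _ heta hx0_psi2) _.
    exact: measurable_norm2.
  by rewrite lee_fin /M mulrDr lerDl mulr_ge0.
apply: (@le_trans _ _ (\int[P]_om
    ((2 * spectral_norm B ^+ 2)%:E * (norm2 (u j om) ^+ 2)%:E
      + 2%:E * (norm2 (w j om) ^+ 2)%:E))%E).
  apply: ge0_le_integral => //.
  - by move=> om _; rewrite lee_fin sqr_ge0.
  - by apply: msq; exact: measurable_addmx.
  - by apply: emeasurable_funD; apply: measurable_funeM; exact: msq.
  - move=> om _; rewrite -!EFinM -EFinD lee_fin.
    have := norm2D (B *m u j om) (w j om).
    have := norm2_mulmx B (u j om).
    have := norm2_ge0 (B *m u j om + w j om).
    have := norm2_ge0 (B *m u j om); have := norm2_ge0 (w j om).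
    set a := norm2 (_ + _); set b := norm2 (B *m _); set c := norm2 (w j om).
    rewrite -mulrA -exprMn; set e := _ * norm2 (u j om) => c0 b0 a0 be abc.
    have : a ^+ 2 <= (b + c) ^+ 2 by rewrite !expr2 ler_pM.
    have : b ^+ 2 <= e ^+ 2 by rewrite !expr2 ler_pM.
    have := sqr_ge0 (b - c); lra.
rewrite ge0_integralD//; last 4 first.
- by move=> om _; rewrite -EFinM lee_fin mulr_ge0 ?sqr_ge0// mulr_ge0 ?sqr_ge0.
- by apply: measurable_funeM; exact: msq.
- by move=> om _; rewrite -EFinM lee_fin mulr_ge0 ?sqr_ge0.
- by apply: measurable_funeM; exact: msq.
rewrite !ge0_integralZl//; last 5 first.
- exact: msq.
- by move=> om _; rewrite lee_fin sqr_ge0.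
- exact: msq.
- by move=> om _; rewrite lee_fin sqr_ge0.
- by rewrite lee_fin mulr_ge0 ?sqr_ge0.
apply: (@le_trans _ _ ((2 * spectral_norm B ^+ 2)%:E * (m%:R * sigma ^+ 2)%:E
    + 2%:E * (eta ^+ 2)%:E)%E).
  apply: leeD; apply: lee_wpmul2l => //; first by rewrite lee_fin mulr_ge0 ?sqr_ge0.
  by apply: gaussian_sqr_norm2_mean => //; exact: hu_law.
rewrite -!EFinM -EFinD lee_fin /M; have := sqr_ge0 eta; lra.
Qed.

Lemma mean_bias t : (\int[P]_om (norm2 (C *m (A ^+ l *m x t om)) ^+ 2)%:E <=
  ((spectral_norm C * (psi * rho ^+ l)) ^+ 2 *
   (psi ^+ 2 * M / (1 - rho) ^+ 2))%:E)%E.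
Proof.
have /andP[r0 r1] := hrho.
have c0 : 0 <= spectral_norm C * (psi * rho ^+ l).
  by rewrite !mulr_ge0 ?spectral_norm_ge0 ?exprn_ge0// ltW.
apply: (@le_trans _ _ (\int[P]_om (((spectral_norm C * (psi * rho ^+ l)) ^+ 2)%:E
    * (norm2 (x t om) ^+ 2)%:E))%E).
  apply: ge0_le_integral => //.
  - by move=> om _; rewrite lee_fin sqr_ge0.
  - apply/measurable_EFinP/measurable_funX/measurable_norm2.
    by apply: measurable_mulmx => //; exact: measurable_mulmx.
  - apply: measurable_funeM; apply/measurable_EFinP/measurable_funX.
    exact: measurable_norm2.
  - move=> om _; rewrite -EFinM lee_fin -exprMn !expr2.
    suff : norm2 (C *m (A ^+ l *m x t om)) <=
        spectral_norm C * (psi * rho ^+ l) * norm2 (x t om).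
      by move=> h; rewrite ler_pM ?norm2_ge0.
    apply: le_trans (norm2_mulmx _ _) _; rewrite -mulrA.
    rewrite ler_wpM2l ?spectral_norm_ge0//.
    by apply: le_trans (norm2_mulmx _ _) _; rewrite ler_wpM2r ?norm2_ge0.
rewrite ge0_integralZl//; last 3 first.
- by apply/measurable_EFinP/measurable_funX; exact: measurable_norm2.
- by move=> om _; rewrite lee_fin sqr_ge0.
- by rewrite lee_fin sqr_ge0.
by rewrite [leRHS]EFinM lee_wpmul2l ?lee_fin ?sqr_ge0//; exact: mean_x.
Qed.

End moments.

Section algorithm.
Variables (p sigma alpha beta : R)
  (G g : nat -> Omega -> 'M[R]_(r, \sum_(i < l.+1) m)) (gamma : nat -> Omega -> R).
Hypotheses (hm : (0 < m)%N) (hp : 0 <= p <= 1) (hl : 1 / 2 < (1 - p) ^+ l)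
  (hxi_law : forall t E, distribution P (xi t) E = bernoulli_prob p E)
  (hxi_indep : mutually_independent P
    (fun t => g_sigma_algebra_preimage (xi t)))
  (hxi_w : forall t, [set omega | xi t omega = false] `<=`
                     [set omega | w t omega = 0])
  (hsigma : 0 < sigma) (hu_law : forall t, isotropic_gaussian P sigma (u t))
  (hu_indep : mutually_independent P
    (fun t => g_sigma_algebra_preimage (u t)))
  (hindep : forall t, mutually_independent P
    (tnth [tuple sigma_future u t; sigma_future xi t; sigma_history x0 w u t]))
  (halpha : 0 < alpha <= 1)
  (hG0 : forall omega, G 0%N omega = 0)
  (hG : forall t omega, (l.+1 %| t)%N ->
    G (t + l.+1)%N omega = G t omega - gamma t omega *: g t omega).

Let Gstar := markov_params l.+1 A B C D.
Let f t omega M := norm2 (y (t + l)%N omega - M *m U (t + l)%N omega).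
Let theta t omega :=
  Num.max ((f t omega (G t omega) - f t omega Gstar)
           / frob_norm (g t omega) ^+ 2) 0.

Hypotheses
  (hg : forall t, (l.+1 %| t)%N -> {ae P, forall omega, g t omega != 0 /\
    subdifferential (f t omega) (G t omega) (g t omega)})
  (hgamma : forall t, (l.+1 %| t)%N -> {ae P, forall omega,
    alpha * theta t omega <= gamma t omega <= (2 - alpha) * theta t omega})
  (hg_sel : forall t, (l.+1 %| t)%N ->
    exists phi : 'M[R]_(r, \sum_(i < l.+1) m) * 'cV[R]_r
                 * 'cV[R]_(\sum_(i < l.+1) m) -> 'M[R]_(r, \sum_(i < l.+1) m),
    measurable_fun setT phi /\ forall omega,
      g t omega = phi (G t omega, y (t + l)%N omega, U (t + l)%N omega))
  (hgamma_sel : forall t, (l.+1 %| t)%N ->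
    exists phi : 'M[R]_(r, \sum_(i < l.+1) m) * 'cV[R]_r
                 * 'cV[R]_(\sum_(i < l.+1) m) -> R,
    measurable_fun setT phi /\ forall omega,
      gamma t omega = phi (G t omega, y (t + l)%N omega, U (t + l)%N omega))
  (hbeta : forall t,
    (\int[P]_om (norm2 (C *m (A ^+ l *m x t om)) ^+ 2)%:E <= beta%:E)%E).

(** The update at t reads nothing after time t + l, which is before the next window starts; the
    selection maps keep the iterate a function of the history. *)
Let history_G t : (l.+1 %| t)%N -> history_measurable t (G t).
Proof.
move=> /dvdnP[j ->] {t}; elim: j => [|j IH].
  rewrite mul0n /history_measurable (_ : G 0%N = cst 0); first exact: measurable_cst.
  by apply/funext => om; rewrite hG0.
rewrite mulSn addnC; set t := (j * l.+1)%N in IH *.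
have kt : (l.+1 %| t)%N by exact: dvdn_mull.
have mGt : history_measurable (t + l.+1) (G t).
  by apply: measurable_sub_generator IH; apply: history_leq; exact: leq_addr.
have [phi [mphi gE]] := hg_sel kt.
have [phi' [mphi' gammaE]] := hgamma_sel kt.
have lt_tl : (t + l < t + l.+1)%N by rewrite ltn_add2l.
have mdata : history_measurable (t + l.+1)
    (fun om => (G t om, y (t + l)%N om, U (t + l)%N om)).
  apply: measurable_fun_pair; last exact: history_U.
  by apply: measurable_fun_pair => //; exact: history_y.
rewrite /history_measurable.
rewrite (_ : G (t + l.+1)%N = (fun om => G t om + - (gamma t om *: g t om))); last first.
  by apply/funext => om; rewrite hG.
apply: measurable_addmx => //; apply: measurable_oppmx; apply: measurable_scalemx.
- by rewrite (funext gammaE : gamma t = _); exact: measurableT_comp mphi' mdata.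
- by rewrite (funext gE : g t = _); exact: measurableT_comp mphi mdata.
Qed.

Let q := 1 - (1 - p) ^+ l.
Let calm t := \big[setI/setT]_(j < l) (xi (t + j)%N @^-1` [set false]).

Let calm_future t : sigma_future xi t (calm t).
Proof.
apply: (@bigsetI_measurable _ (g_sigma_algebraType _)) => j _.
apply: sub_gen_smallest; exists (t + j)%N; first exact: leq_addr.
by exists [set false]; rewrite ?setTI.
Qed.

Let future_U t V : measurable V -> sigma_future u t (U (t + l)%N @^-1` V).
Proof.
move=> mV; apply: preimage_generator mV _.
apply: measurable_mx => i j; rewrite (ord1 j).
rewrite (_ : (fun om => _) =
  (fun om => u (t + l - tagnat.sig1 i)%N om (tagnat.sig2 i) 0)); last first.
  by apply/funext => om; rewrite /U stacked_inputE.
apply: measurable_mx_coord; apply: measurable_generator => F hF.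
exists (t + l - tagnat.sig1 i)%N => //=.
by have := ltn_ord (tagnat.sig1 i); lia.
Qed.

Let error t om := G t om - Gstar.

Let history_error t : (l.+1 %| t)%N -> history_measurable t (error t).
Proof. by move=> kt; apply: measurable_addmx => //; exact: history_G. Qed.

(** The window ending at t + l consists of inputs from time t on, and [calm] of indicators from time
    t on, so the standing convention at t gives the three independent factors. *)
Let indep_error t V W E : (l.+1 %| t)%N -> measurable V -> measurable W ->
  E = calm t \/ E = ~` calm t ->
  P (error t @^-1` V `&` U (t + l)%N @^-1` W `&` E) =
  (P (error t @^-1` V) * P (U (t + l)%N @^-1` W) * P E)%E.
Proof.
move=> kt mV mW hE.
have fE : sigma_future xi t E.
  case: hE => ->; first exact: calm_future.
  by apply: sigma_algebraC; exact: calm_future.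
have hV := preimage_generator mV (history_error kt).
pose F := tnth [tuple U (t + l)%N @^-1` W; E; error t @^-1` V].
have := @hindep t [:: ord0; lift ord0 ord0; ord_max] F.
rewrite !big_cons !big_nil /F !(tnth_nth set0)/=.
move=> /(_ isT) h.
rewrite -setIA setIC -setIA [LHS](_ : _ =
  P (U (t + l)%N @^-1` W `&` (E `&` (error t @^-1` V `&` setT)))); last first.
  by rewrite setIT.
rewrite h; first by rewrite mule1 muleCA muleC -muleA muleCA muleA.
move=> i; rewrite !inE => /or3P[] /eqP ->; rewrite !(tnth_nth set0)/=.
- exact: future_U.
- exact: fE.
- exact: hV.
Qed.

Let bias t om := C *m (A ^+ l *m x t om).

(** In a calm window the losses are |b - e| and |b|, and the triangle inequality gives a gap of at
    least |e| - 2 |b|. Otherwise an attack term v shifts both losses alike, and the gap is at least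
    - |e| whatever v is. *)
Let loss_gap t om :
  (\1_(calm t) om - \1_(~` calm t) om) * norm2 (error t om *m U (t + l)%N om)
    - 2 * norm2 (bias t om) <= f t om (G t om) - f t om Gstar.
Proof.
pose v := \sum_(j < l) C *m (A ^+ (l - j.+1) *m w (t + j)%N om).
have yE : y (t + l)%N om = Gstar *m U (t + l)%N om + bias t om + v.
  exact: (output_decomposition (fun s => hx s om) t l (fun s => hy s om)).
have fGs : f t om Gstar = norm2 (bias t om + v).
  by rewrite /f yE -(addrA _ (bias t om)) [in LHS]addrC addrK.
have fG : f t om (G t om) = norm2 (bias t om + v - error t om *m U (t + l)%N om).
  congr norm2; rewrite yE /error mulmxBl opprB; set a := Gstar *m _.
  by rewrite -(addrA a) (addrC a) addrA.
rewrite fG fGs; set e := error t om *m _; set b := bias t om.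
have b0 := norm2_ge0 b.
have [calm_om|stormy] := pselect (calm t om).
  have v0 : v = 0.
    apply: big1 => j _; rewrite (_ : w _ om = 0) ?mulmx0//.
    apply: hxi_w; move: calm_om.
    rewrite /calm -(bigcap_mkord l (fun i => xi (t + i)%N @^-1` [set false])).
    by apply; exact: ltn_ord.
  rewrite !indicE mem_set// memNset ?subr0 ?mul1r; last by move=> /(_ calm_om).
  have := norm2D b (- (b - e)); rewrite norm2N opprB addrC subrK v0 addr0; lra.
rewrite !indicE memNset// mem_set// sub0r mulN1r.
have := norm2D (b + v - e) e; rewrite subrK; lra.
Qed.

Let kappa := 2 * alpha - alpha ^+ 2.

Let N := (\sum_(i < l.+1) m)%N.

Let one_step t eps : (l.+1 %| t)%N ->
  (\int[P]_om (frob_norm (error t om) ^+ 2)%:E <= eps%:E)%E ->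
  (\int[P]_om (frob_norm (error (t + l.+1)%N om) ^+ 2)%:E <=
   ((1 - (1 - 2 * q) ^+ 2 * kappa / (2 * pi * N%:R)) * eps
    + kappa * 36 / (N%:R * sigma ^+ 2) * beta)%:E)%E.
Proof.
move=> kt heps; have /andP[alpha0 alpha1] := halpha; have /andP[p0 p1] := hp.
have merror s : (l.+1 %| s)%N -> measurable_fun setT (error s).
  by move=> ks; exact: measurable_from_generator (@history_sub s) (history_error ks).
have mcalm : measurable (calm t).
  apply: bigsetI_measurable => j _; rewrite -[X in measurable X]setTI.
  exact: measurable_funPT.
have kap0 : 0 <= kappa by rewrite /kappa; nra.
have kap1 : kappa <= 1 by rewrite /kappa; have := sqr_ge0 (alpha - 1); nra.
apply: (@contraction_step _ _ _ P _ _ (error t) (error (t + l.+1)%N) (U (t + l)%N)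
  (bias t) (calm t)) => //.
- by rewrite sum_nat_const card_ord muln_gt0.
- by rewrite /q subr_ge0 exprn_ile1//; lra.
- by rewrite /q; have := hl; lra.
- exact: merror.
- by apply: merror; exact: dvdn_add.
- by apply: measurable_mulmx => //; exact: measurable_mulmx.
- by apply: isotropic_gaussian_stacked => //; rewrite ltnS leq_addl.
- by rewrite (prob_no_attack _ _ hp hxi_law hxi_indep) /q subKr.
- by move=> V W E mV mW; exact: indep_error.
- apply: filterS2 (hgamma kt) (hg kt) => om gam [gn0 sub] lam lam0.
  have lip : f t om (G t om + g t om) <=
      f t om (G t om) + frob_norm (g t om) * norm2 (U (t + l)%N om).
    rewrite /f mulmxDl opprD addrA; apply: le_trans (norm2D _ _) _.
    by rewrite norm2N lerD2l norm2_mul_frob.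
  have := polyak_step gn0 sub lip halpha gam lam0.
  rewrite -hG// => /le_trans; apply; rewrite lerD2l lerN2 ler_wpM2l//.
  rewrite lerD2r ler_wpM2l ?mulr_ge0//; exact: loss_gap.
- exact: hbeta.
Qed.

(** The additive term is the fixed point of the affine recursion of [one_step], so the excess over
    it shrinks by 1 - rate per window. *)
Lemma mean_sqr_error t : (l.+1 %| t)%N ->
  (\int[P]_om (frob_norm (G t om - Gstar) ^+ 2)%:E <=
   ((1 - (1 - 2 * q) ^+ 2 * kappa / (2 * pi * m%:R * l.+1%:R)) ^+ (t %/ l.+1)
      * frob_norm (0 - Gstar) ^+ 2
    + 72 * pi * beta / (sigma ^+ 2 * (1 - 2 * q) ^+ 2))%:E)%E.
Proof.
have NE : N%:R = m%:R * l.+1%:R :> R by rewrite /N sum_nat_const card_ord mulnC natrM.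
have Np : 0 < N%:R :> R by rewrite NE mulr_gt0 ?ltr0n.
have /andP[alpha0 alpha1] := halpha; have /andP[p0 p1] := hp.
have q1 : 0 < 1 - 2 * q by rewrite /q; have := hl; lra.
have pi0 := pi_gt0 R.
rewrite -(mulrA (2 * pi)) -NE.
set rate := (1 - 2 * q) ^+ 2 * kappa / _.
set floor := 72 * pi * beta / _.
have beta0 : 0 <= beta.
  rewrite -lee_fin; apply: le_trans (hbeta 0).
  by apply: integral_ge0 => om _; rewrite lee_fin sqr_ge0.
have floor0 : 0 <= floor.
  by rewrite divr_ge0 ?mulr_ge0 ?sqr_ge0// ltW.
move=> /dvdnP[j ->]; rewrite mulnK//.
elim: j => [|j IH].
  rewrite mul0n expr0 mul1r; under eq_integral do rewrite hG0.
  rewrite integral_cst// [X in (_ * X)%E]probability_setT mule1 lee_fin.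
  by rewrite lerDl.
rewrite mulSn addnC; apply: le_trans (one_step (dvdn_mull _ (dvdnn _)) IH) _.
have fixed_point : rate * floor = kappa * 36 / (N%:R * sigma ^+ 2) * beta.
  by rewrite /rate /floor; move: (pi) pi0 => c c0; field; rewrite !gt_eqF.
rewrite lee_fin -/rate -fixed_point (exprS _ j) le_eqVlt; apply/orP; left; apply/eqP.
ring.
Qed.

End algorithm.

End system_identification.

(** * Constants and conclusion *)

Lemma bernoulli_inequality {R : realType} (p : R) l : 0 <= p <= 1 ->
  1 - l%:R * p <= (1 - p) ^+ l.
Proof.
move=> /andP[p0 p1]; elim: l => [|l IH]; first by rewrite mul0r subr0 expr0.
rewrite exprS -natr1; have := ler_wpM2l (_ : 0 <= 1 - p) IH.
rewrite subr_ge0 => /(_ p1); apply: le_trans.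
have : 0 <= l%:R * p ^+ 2 by rewrite mulr_ge0 ?sqr_ge0.
nra.
Qed.

(** Here delta stands for 1 - 2 q. The constant 288 is 72 from the recursion times 4 from the state
    moment, and psi^4 combines psi^2 from the decay of the bias over a window with psi^2 from the
    state moment. *)
Lemma final_constants {R : realType} (psi rho c b eta sigma delta X alpha : R)
    (m k l j : nat) : (0 < m)%N -> (0 < k)%N -> 0 < psi -> 0 <= rho < 1 ->
  0 <= c -> 0 <= b -> 0 < eta -> 0 < sigma -> 0 < delta <= 1 -> 0 <= X ->
  0 < alpha <= 1 ->
  let rate := delta ^+ 2 * (2 * alpha - alpha ^+ 2) / (2 * pi * m%:R * k%:R) in
  let beta := (c * (psi * rho ^+ l)) ^+ 2 *
    (psi ^+ 2 * (4 * (eta ^+ 2 + b ^+ 2 * (m%:R * sigma ^+ 2))) / (1 - rho) ^+ 2) in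
  (1 - rate) ^+ j * X + 72 * pi * beta / (sigma ^+ 2 * delta ^+ 2) <=
  (1 + 288 * pi * psi ^+ 4) * ((1 - rate) ^+ j * X +
    (rho ^+ l * (c / delta * (eta / sigma + Num.sqrt m%:R * b)) / (1 - rho)) ^+ 2).
Proof.
move=> m0 k0 psi0 /andP[rho0 rho1] c0 b0 eta0 sigma0 /andP[d0 d1] X0.
move=> /andP[alpha0 alpha1]; cbv zeta.
set rate := _ / (2 * pi * _ * _); set beta := _ * (_ / _).
have pi0 := pi_gt0 R; have pi2 := pi_ge2 R.
have psi4 : 0 <= 288 * pi * psi ^+ 4 :=
  mulr_ge0 (mulr_ge0 (ler0n R 288) (pi_ge0 R)) (exprn_ge0 4 (ltW psi0)).
have rho1' : 0 < 1 - rho by rewrite subr_gt0.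
have rate1 : 0 <= 1 - rate.
  rewrite subr_ge0 /rate.
  have m1 : 1 <= m%:R :> R by rewrite ler1n.
  have k1 : 1 <= k%:R :> R by rewrite ler1n.
  have pi1 : 1 <= 2 * pi :> R by move: pi2; lra.
  have D1 := mulr_ege1 (mulr_ege1 pi1 m1) k1.
  rewrite ler_pdivrMr ?(lt_le_trans _ D1)// mul1r (le_trans _ D1)//.
  apply: mulr_ile1; rewrite ?sqr_ge0 ?exprn_ile1 ?(ltW d0)//; nra.
pose W := 288 * pi * psi ^+ 4 * (rho ^+ l * c / (delta * (1 - rho))) ^+ 2.
have -> : 72 * pi * beta / (sigma ^+ 2 * delta ^+ 2) =
    W * ((eta / sigma) ^+ 2 + m%:R * b ^+ 2).
  rewrite /W /beta; move: (pi) => z.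
  by field; rewrite !gt_eqF.
have main0 : 0 <= (1 - rate) ^+ j * X by rewrite mulr_ge0 ?exprn_ge0.
set V := eta / sigma + _.
have sqm : Num.sqrt m%:R ^+ 2 = m%:R :> R by rewrite sqr_sqrtr.
(* The moments add in squares, while nu contains the sum of the square roots; the cross term is
   nonnegative. *)
have V2 : (eta / sigma) ^+ 2 + m%:R * b ^+ 2 <= V ^+ 2.
  rewrite /V sqrrD (exprMn 2 (Num.sqrt _)) sqm -addrA lerD2l lerDr mulrn_wge0// mulr_ge0//.
    by rewrite divr_ge0// ltW.
  by rewrite mulr_ge0 ?sqrtr_ge0.
have W0 : 0 <= W by rewrite mulr_ge0 ?sqr_ge0.
have := ler_wpM2l W0 V2.
rewrite (_ : W * V ^+ 2 = 288 * pi * psi ^+ 4 *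
    (rho ^+ l * (c / delta * V) / (1 - rho)) ^+ 2); last first.
  by rewrite /W; move: (pi) => z; field; rewrite !gt_eqF.
set Y := (_ / (1 - rho)) ^+ 2.
have Y0 : 0 <= Y by rewrite sqr_ge0.
have := mulr_ge0 psi4 main0; lra.
Qed.

Theorem theorem3 (R : realType) (psi : R) (hpsi : 0 < psi) :
  exists K : R, 0 < K /\
  forall (n m r k : nat) (hn : (1 <= n)%N) (hm : (1 <= m)%N) (hr : (1 <= r)%N)
    (hk : (2 <= k)%N)
    (A : 'M[R]_n) (B : 'M[R]_(n, m)) (C : 'M[R]_(r, n)) (D : 'M[R]_(r, m))
    (d : measure_display) (Omega : measurableType d) (P : probability Omega R)
    (x0 : {RV P >-> 'cV[R]_n}) (u : nat -> {RV P >-> 'cV[R]_m})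
    (w : nat -> {RV P >-> 'cV[R]_n}) (xi : nat -> {RV P >-> bool})
    (x : nat -> Omega -> 'cV[R]_n) (y : nat -> Omega -> 'cV[R]_r)
    (hx0 : forall omega, x 0%N omega = x0 omega)
    (hx : forall t omega,
        x t.+1 omega = A *m x t omega + B *m u t omega + w t omega)
    (hy : forall t omega, y t omega = C *m x t omega + D *m u t omega)
    (* (i) *)
    (rho : R) (hrho : 0 <= rho < 1)
    (hA : forall t : nat, spectral_norm (A ^+ t) <= psi * rho ^+ t)
    (* (ii) *)
    (eta : R) (heta : 0 < eta)
    (hx0_psi2 : (psi2_norm P (fun omega => norm2 (x0 omega)) <= eta%:E)%E)
    (hw_psi2 : forall t, cond_psi2_le P (sigma_Ft x0 w t)
                           (fun omega => norm2 (w t omega)) eta)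
    (* (iii) *)
    (p : R) (hp : 0 <= p < 1 / (2 * (k - 1)%:R))
    (hxi_law : forall t (E : set bool),
        distribution P (xi t) E = bernoulli_prob p E)
    (hxi_indep : mutually_independent P
        (fun t => g_sigma_algebra_preimage (xi t)))
    (hxi_Ft : forall t, mutually_independent P
        (tnth [tuple g_sigma_algebra_preimage (xi t); sigma_Ft x0 w t]))
    (hxi_w : forall t, [set omega | xi t omega = false] `<=`
                       [set omega | w t omega = 0])
    (* (iv) *)
    (sigma : R) (hsigma : 0 < sigma)
    (hu_law : forall t, isotropic_gaussian P sigma (u t))
    (hu_indep : mutually_independent P
        (fun t => g_sigma_algebra_preimage (u t)))
    (* standing convention *)
    (hindep : forall t, mutually_independent P
        (tnth [tuple sigma_future u t; sigma_future xi t;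
                     sigma_history x0 w u t]))
    (* stochastic subgradient method with Polyak step size *)
    (alpha : R) (halpha : 0 < alpha <= 1)
    (G g : nat -> Omega -> 'M[R]_(r, \sum_(i < k) m))
    (gamma : nat -> Omega -> R)
    (hG0 : forall omega, G 0%N omega = 0)
    (hG : forall t omega, (k %| t)%N ->
        G (t + k)%N omega = G t omega - gamma t omega *: g t omega),
  let Gstar := markov_params k A B C D in
  let U t omega := stacked_input k (fun s => u s omega) t in
  let f t omega M := norm2 (y (t + k - 1)%N omega - M *m U (t + k - 1)%N omega) in
  let theta t omega :=
    Num.max ((f t omega (G t omega) - f t omega Gstar)
             / frob_norm (g t omega) ^+ 2) 0 in
  let q : R := 1 - (1 - p) ^+ (k - 1) in
  let nu : R := spectral_norm C / (1 - 2 * q)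
            * (eta / sigma + Num.sqrt m%:R * spectral_norm B) in
  forall
    (hg : forall t, (k %| t)%N -> {ae P, forall omega,
        g t omega != 0 /\
        subdifferential (f t omega) (G t omega) (g t omega)})
    (hgamma : forall t, (k %| t)%N -> {ae P, forall omega,
        alpha * theta t omega <= gamma t omega <= (2 - alpha) * theta t omega})
    (hg_sel : forall t, (k %| t)%N ->
        exists phi : 'M[R]_(r, \sum_(i < k) m) * 'cV[R]_r
                     * 'cV[R]_(\sum_(i < k) m) -> 'M[R]_(r, \sum_(i < k) m),
        measurable_fun setT phi /\
        forall omega, g t omega =
          phi (G t omega, y (t + k - 1)%N omega, U (t + k - 1)%N omega))
    (hgamma_sel : forall t, (k %| t)%N ->
        exists phi : 'M[R]_(r, \sum_(i < k) m) * 'cV[R]_r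
                     * 'cV[R]_(\sum_(i < k) m) -> R,
        measurable_fun setT phi /\
        forall omega, gamma t omega =
          phi (G t omega, y (t + k - 1)%N omega, U (t + k - 1)%N omega)),
  forall t, (k %| t)%N ->
    ('E_P[(fun omega => frob_norm (G t omega - Gstar) ^+ 2)%R] <=
     (K * ((1 - (1 - 2 * q) ^+ 2 * (2 * alpha - alpha ^+ 2)
                / (2 * pi * m%:R * k%:R)) ^+ (t %/ k)
             * frob_norm (0 - Gstar) ^+ 2
           + (rho ^+ (k - 1) * nu / (1 - rho)) ^+ 2))%R%:E)%E.
Proof.
have psi4 : 0 <= 288 * pi * psi ^+ 4 :=
  mulr_ge0 (mulr_ge0 (ler0n R 288) (pi_ge0 R)) (exprn_ge0 4 (ltW hpsi)).
exists (1 + 288 * pi * psi ^+ 4); split; first exact: ltr_pwDl ltr01 psi4.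
move=> n m r k hn hm hr; case: k => [//|l] hl A B C D d Omega P x0 u w xi x y.
move=> hx0 hx hy rho hrho hA eta heta hx0_psi2 hw_psi2 p hp hxi_law hxi_indep.
move=> hxi_Ft hxi_w sigma hsigma hu_law hu_indep hindep alpha halpha G g gamma.
move=> hG0 hG Gstar U f theta q nu hg hgamma hg_sel hgamma_sel t kt.
have Tl s : (s + l.+1 - 1 = s + l)%N by rewrite addnS subn1.
have l1 : (l.+1 - 1 = l)%N by rewrite subn1.
have l0 : 0 < l%:R :> R by rewrite ltr0n.
have /andP[p0 pl] : 0 <= p < 1 / (2 * l%:R) by move: hp; rewrite l1.
have pl2 : l%:R * p < 1 / 2.
  by move: pl; rewrite ltr_pdivlMr ?mulr_gt0//; lra.
have p1 : p <= 1.
  have l1R : 1 <= l%:R :> R by rewrite ler1n.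
  by nra.
have hp01 : 0 <= p <= 1 by rewrite p0.
(* This is q < 1/2: calm windows outweigh attacked ones, which is where the bound on p enters. *)
have half : 1 / 2 < (1 - p) ^+ l.
  by apply: lt_le_trans (bernoulli_inequality l hp01); lra.
pose M := 4 * (eta ^+ 2 + spectral_norm B ^+ 2 * (m%:R * sigma ^+ 2)).
pose beta := (spectral_norm C * (psi * rho ^+ l)) ^+ 2 *
  (psi ^+ 2 * M / (1 - rho) ^+ 2).
have hbeta s : (\int[P]_om (norm2 (C *m (A ^+ l *m x s om)) ^+ 2)%:E <= beta%:E)%E.
  exact: (mean_bias C hx0 hx hpsi hrho hA heta hx0_psi2 hw_psi2 hsigma hu_law).
rewrite unlock.
have bound := @mean_sqr_error R n m r l d Omega A B C D P x0 u w xi x y hx0 hx hy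
  p sigma alpha beta G g gamma hm hp01 half hxi_law hxi_indep hxi_w hsigma hu_law
  hu_indep hindep halpha hG0 hG.
apply: le_trans (bound _ _ _ _ hbeta t kt) _.
- by move=> s ks; have := hg s ks; rewrite /f /U Tl.
- by move=> s ks; have := hgamma s ks; rewrite /theta /f /U Tl.
- by move=> s ks; have := hg_sel s ks; rewrite /U Tl.
- by move=> s ks; have := hgamma_sel s ks; rewrite /U Tl.
rewrite /nu /q !l1 lee_fin.
apply: final_constants => //; rewrite ?spectral_norm_ge0 ?sqr_ge0//.
by have := exprn_ile1 l (_ : 0 <= 1 - p); lra.
Qed.
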